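(* Fix $k\ge 1$. Then, for all $n$, $$Q_n(\Pi_{k,2})=Q_n(\Pi_{k,1})=\sum_{\lambda\in H_{n,k+1}} f^{\overline\lambda}\, s_\lambda,$$ where $\overline\lambda$ is the partition $\lambda$ with its first part $\lambda_1$ replaced by $\min\{\lambda_1,k\}$.
   Context: $\mathfrak S_n$ is the set of permutations $\pi=\pi_1\cdots\pi_n$ of $[n]=\{1,\dots,n\}$. A permutation $\sigma$ contains $\pi$ if some (not necessarily contiguous) subsequence of $\sigma$ is order isomorphic to $\pi$; otherwise it avoids $\pi$. $\mathfrak S_n(\Pi)$ is the set of $\sigma\in\mathfrak S_n$ avoiding every $\pi\in\Pi$. The descent set of $\sigma\in\mathfrak S_n$ is $\mathrm{Des}\,\sigma=\{i\in[n-1]\mid \sigma_i>\sigma_{i+1}\}$. For $S\subseteq[n-1]$ the fundamental quasisymmetric function (of degree $n$, in variables $x_1,x_2,\dots$) is $F_S=\sum x_{i_1}\cdots x_{i_n}$, the sum over all $i_1\le\cdots\le i_n$ with $i_j<i_{j+1}$ whenever $j\in S$. Define $Q_n(\Pi)=\sum_{\sigma\in\mathfrak S_n(\Pi)}F_{\mathrm{Des}\,\sigma}$. $\Pi_{k,2}\subseteq\mathfrak S_{k+2}$ is the set of all permutations of $[k+2]$, other than the identity, obtained by inserting $k+2$ in some position of the sequence $1,2,\dots,k,k+1$ (i.e. the shuffles of $1,2,\dots,k+1$ with $k+2$, minus the identity). $\Pi_{k,1}\subseteq\mathfrak S_{k+2}$ is the set of all permutations of $[k+2]$, other than the identity, obtained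 by inserting $k+1$ in some position of the sequence $1,2,\dots,k,k+2$. $H_{n,m}$ is the set of partitions $\lambda\vdash n$ whose Young diagram does not contain the box $(2,m)$ (row $2$, column $m$). $s_\lambda$ is the Schur function and $f^\mu$ is the number of standard Young tableaux of shape $\mu$. *)

(* Defs.v *)
From HB Require Import structures.
From mathcomp Require Import all_boot all_order all_algebra all_fingroup.
From mathcomp Require Import finmap.
From mathcomp Require Import boolp classical_sets functions cardinality fsbigop.
From mathcomp.multinomials Require Import monalg.

Set Implicit Arguments.
Unset Strict Implicit.
Unset Printing Implicit Defensive.

Import GRing.Theory.
Local Open Scope ring_scope.

(* 'S_n permutes 'I_n = {0, ..., n-1}; [one_line s] is the word
   s_1 ... s_n with letters in {1, ..., n}. *)
Definition one_line n (s : 'S_n) : seq nat :=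
  [seq (nat_of_ord (s i)).+1 | i <- enum 'I_n].

(* [f] selects the positions of the subsequence. *)
Definition contains m n (s : 'S_n) (p : 'S_m) : bool :=
  [exists f : {ffun 'I_m -> 'I_n}, [forall a : 'I_m, [forall b : 'I_m,
    ((a < b)%N ==> (f a < f b)%N) &&
    ((p a < p b)%N == (s (f a) < s (f b))%N)]]].

Definition avoiders m n (P : {set 'S_m}) : {set 'S_n} :=
  [set s | [forall p in P, ~~ contains s p]].

Definition insert (j x : nat) (w : seq nat) : seq nat :=
  take j w ++ x :: drop j w.

Definition Pi_k2 (k : nat) : {set 'S_k.+2} :=
  [set p : 'S_k.+2 | (p != 1%g) &&
    [exists j : 'I_k.+2, one_line p == insert j k.+2 (iota 1 k.+1)]].

Definition Pi_k1 (k : nat) : {set 'S_k.+2} :=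
  [set p : 'S_k.+2 | (p != 1%g) &&
    [exists j : 'I_k.+2, one_line p == insert j k.+1 (rcons (iota 1 k) k.+2)]].

(* A series is given by its coefficients; [ucm i] is the variable x_(i+1).
   Addition is the pointwise addition of functions. *)
Definition series := {cmonom nat} -> int.

(* The (possibly infinite) sum of the monomials [w a] for [a] in [A]; it is
   meaningful when each monomial occurs for finitely many [a] only. *)
Definition monomial_sum (I : choiceType) (A : set I) (w : I -> {cmonom nat}) :
    series :=
  fun m => \sum_(a \in A) ((w a == m)%:R : int).

(* The ordinal [i : 'I_n.-1] stands for the position i+1 of [n-1], both here
   and in [fundamental]. *)
Definition Des n (s : 'S_n) : {set 'I_n.-1} :=
  [set i : 'I_n.-1 | (nth 0%N (one_line s) i > nth 0%N (one_line s) i.+1)%N].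

Definition fundamental n (S : {set 'I_n.-1}) : series :=
  monomial_sum
    [set t : n.-tuple nat | forall i : 'I_n.-1,
      (nth 0%N t i <= nth 0%N t i.+1)%N /\
      (i \in S -> (nth 0%N t i < nth 0%N t i.+1)%N)]%classic
    (fun t => \big[mmul/mone]_(x <- t) ucm x).

Definition Q m n (P : {set 'S_m}) : series :=
  \sum_(s in avoiders n P) fundamental (Des s).

Definition is_part (n : nat) (la : seq nat) : bool :=
  [&& sorted geq la, 0%N \notin la & sumn la == n].

(* Boxes are pairs (row, column), numbered from 1. *)
Definition diagram (la : seq nat) : seq (nat * nat) :=
  [seq (i, j) | i <- iota 1 (size la), j <- iota 1 (nth 0%N la i.-1)].

Definition box (la : seq nat) := seq_sub (diagram la).
Definition row_of la (b : box la) : nat := (val b).1.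
Definition col_of la (b : box la) : nat := (val b).2.

(* The entry i of a semistandard tableau stands for the positive integer i+1,
   in accordance with the numbering of the variables; similarly for the entries
   of standard tableaux, which are the ordinals below [sumn la]. *)
Definition is_ssyt la (T : {ffun box la -> nat}) : bool :=
  [forall b : box la, [forall c : box la,
    ((row_of b == row_of c) && (col_of b < col_of c)%N ==> (T b <= T c)%N) &&
    ((col_of b == col_of c) && (row_of b < row_of c)%N ==> (T b < T c)%N)]].

Definition is_syt la (T : {ffun box la -> 'I_(sumn la)}) : bool :=
  injectiveb T && [forall b : box la, [forall c : box la,
    ((row_of b == row_of c) && (col_of b < col_of c)%N ==> (T b < T c)%N) &&
    ((col_of b == col_of c) && (row_of b < row_of c)%N ==> (T b < T c)%N)]].

Definition num_syt (la : seq nat) : nat :=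
  #|[set T : {ffun box la -> 'I_(sumn la)} | is_syt T]|.

Definition schur (la : seq nat) : series :=
  monomial_sum [set T : {ffun box la -> nat} | is_ssyt T]%classic
    (fun T => \big[mmul/mone]_(b : box la) ucm (T b)).

Definition H (n m : nat) : set (seq nat) :=
  [set la : seq nat | is_part n la /\ (2, m)%N \notin diagram la]%classic.

Definition cut_first (k : nat) (la : seq nat) : seq nat :=
  if la is a :: la' then minn a k :: la' else [::].

(* Main.v *)
Require Import Defs.
From mathcomp Require Import all_boot all_order all_algebra all_fingroup.
From mathcomp Require Import finmap.
From mathcomp Require Import boolp classical_sets functions cardinality fsbigop.
From mathcomp.multinomials Require Import monalg.
From mathcomp Require Import zify.

(** Both sides are counted, monomial by monomial, by words.

    A permutation [s] together with a monomial of the fundamental series of its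
    descent set is the same thing as a word [u] of length [n] over the natural
    numbers: the weakly increasing sequence of the letters of [u] gives the
    monomial, and [s] lists the positions of [u] in the stable sorted order
    ([std], [fundamental_coef]).  So the coefficient of a monomial in [Q n P]
    is the number of words [u] with this content such that [std u]
    avoids the patterns of [P] ([Q_coef]).  Occurrences of patterns in [std u] can be
    read in [u]: some pattern of [Pi_k2 k] (resp. [Pi_k1 k]) occurs if and only
    if [u] has a subsequence of length [k + 2] that is not weakly increasing
    but becomes so when its last (resp. last but one) letter is deleted
    ([contains_inserted_lift_perm]).

    The rank of a letter of [u] is the length of the longest weakly increasing
    subsequence ending there; by Schensted, it is the number, counted from 1,
    of the column where the letter enters the first row of the insertion tableau
    ([increasing_subseq_row1]).
    The words avoiding [Pi_k2 k] are those where a letter of rank above [k] is never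
    followed by a smaller one ([rising_tail]); those avoiding [Pi_k1 k] are given by
    the condition [rising_runs].  In both cases the word is determined by the
    subword [v] of its letters of rank at most [k] and by the multiset [U] of
    the other ones, and the pairs [(v, U)] that occur are the same: every letter
    of [U] must have rank above [k] after [v].  In the first class [U] is sorted
    and put after [v] ([rising_tail_low_high]); in the second one each letter
    of [U] goes into a sorted run right after the first letter of rank [k] of [v]
    that does not exceed it ([merge_runs]).  Exchanging these two arrangements does not
    change the content, whence the first equality ([nelem_rising_runs]).

    For the Schur expansion, the Robinson-Schensted-Knuth correspondence maps
    words bijectively to pairs of a semistandard tableau [T] and a standard
    tableau of the same shape, the latter encoded by the word [y] of the rows
    where the successive boxes appear ([rsk_inj], [rsk_surj]).  The words of the
    first class are those such that, once the first row of the tableau is longer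
    than [k], all new boxes appear in the first row ([rising_tail_rsk]).
    Such a [y] consists of the word of a standard tableau whose first
    row has been cut to length [k], followed by zeros ([zeros_beyond_decomp]);
    its second row is therefore no longer than [k], and for a given shape [la]
    there are [num_syt (cut_first k la)] choices ([nelem_cut_first]), all
    compatible with every semistandard tableau of shape [la]. *)

Set Implicit Arguments.
Unset Strict Implicit.
Unset Printing Implicit Defensive.

Import GRing.Theory.

(** * Row insertion *)

Lemma nth_sorted_count (p : pred nat) r j :
  (forall a b, a <= b -> p b -> p a) -> sorted leq r -> j < size r ->
  p (nth 0 r j) = (j < count p r).
Proof.
move=> pdown; elim: r j => [//|a r IHr] j /= ar ltj.
have sr : sorted leq r by exact: path_sorted ar.
have alla : all (leq a) r by rewrite (order_path_min leq_trans).
case pa: (p a) => /=; first by case: j ltj => [|j] //= ltj; rewrite IHr.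
have np b : b \in r -> p b = false.
  by move=> br; apply/negP => /(pdown a) pb; rewrite pb // in pa; exact: (allP alla).
have -> : count p r = 0 by apply/eqP; rewrite -leqn0 leqNgt -has_count -all_predC;
  apply/allP => b /np /= ->.
by case: j ltj => [|j] //= ltj; rewrite np // mem_nth.
Qed.

(** The column where [x] enters the sorted row [r]: that of the leftmost entry
    greater than [x], or the end of the row. *)
Definition insert_pos x r := count (fun y => y <= x) r.
(** As [set_nth] extends its argument, this covers both the case where an
    entry is bumped and the case where [x] is appended. *)
Definition row_insert x r := set_nth 0 r (insert_pos x r) x.

Lemma insert_posP x r j : sorted leq r -> j < size r ->
  (nth 0 r j <= x) = (j < insert_pos x r).
Proof.
by move=> sr ltj; rewrite -(nth_sorted_count _ sr ltj) // => a b; exact: leq_trans.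
Qed.

Lemma insert_pos_size x r : insert_pos x r <= size r.
Proof. exact: count_size. Qed.

Lemma nth_row_insert x r j :
  nth 0 (row_insert x r) j = if j == insert_pos x r then x else nth 0 r j.
Proof. by rewrite nth_set_nth. Qed.

Lemma size_row_insert x r : size (row_insert x r) = maxn (insert_pos x r).+1 (size r).
Proof. by rewrite size_set_nth. Qed.

Lemma sorted_nthP r :
  sorted leq r <-> (forall i j, i <= j -> j < size r -> nth 0 r i <= nth 0 r j).
Proof.
split=> [sr i j leij ltj|H].
  by apply: (sorted_leq_nth leq_trans leqnn 0 sr) => //; rewrite inE; lia.
by apply/(sortedP 0) => i lti; apply: H.
Qed.

Lemma row_insert_sorted x r : sorted leq r -> sorted leq (row_insert x r).
Proof.
move=> sr; apply/sorted_nthP => i j leij;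
  rewrite size_row_insert !nth_row_insert => ltj.
have lep := insert_pos_size x r.
case: eqP => [ei|ni]; case: eqP => [ej|nj] //.
- have ltjr : j < size r by lia.
  by have := insert_posP x sr ltjr; lia.
- have ltir : i < size r by lia.
  by rewrite insert_posP //; lia.
- by move/sorted_nthP: sr; apply; lia.
Qed.

Lemma row_insert_perm x r : 
  perm_eq (if insert_pos x r < size r then nth 0 r (insert_pos x r) :: row_insert x r
           else row_insert x r) (x :: r).
Proof.
have lep := insert_pos_size x r.
case: ltnP => [ltp|gep].
  rewrite /row_insert set_nthE ltp -[r in X in perm_eq _ X](cat_take_drop (insert_pos x r)) .
  rewrite (drop_nth 0 ltp) -!cat_cons -cat1s perm_sym.
  by apply/seq.permP => a; rewrite /= !count_cat /=; lia.
rewrite /row_insert set_nthE ltnNge gep /= .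
have -> : insert_pos x r - size r = 0 by lia.
by rewrite /= cats1 perm_rcons.
Qed.

(** * Insertion into a tableau and its inverse *)

(** Schensted insertion of [x] into the tableau with list of rows [T]; the
    second component is the index of the row that gets the new box. *)
Fixpoint tab_insert (x : nat) (T : seq (seq nat)) : seq (seq nat) * nat :=
  if T is r :: T' then
    if insert_pos x r < size r then
      let: (T1, i) := tab_insert (nth 0 r (insert_pos x r)) T' in (row_insert x r :: T1, i.+1)
    else (row_insert x r :: T', 0)
  else ([:: [:: x]], 0).

Definition dominates (r r' : seq nat) :=
  size r' <= size r /\ forall j, j < size r' -> nth 0 r j < nth 0 r' j.

(** Semistandard tableaux, as lists of nonempty rows; the column condition is
    imposed on adjacent rows. *)
Fixpoint tableau (T : seq (seq nat)) : Prop :=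
  if T is r :: T' then
    [/\ 0 < size r, sorted leq r, dominates r (head [::] T') & tableau T']
  else True.

Lemma head_tab_insert x T : head [::] (tab_insert x T).1 = row_insert x (head [::] T).
Proof. by case: T => //= r T; case: ifP => // _; case: tab_insert. Qed.

Lemma tableau_head_sorted T : tableau T -> sorted leq (head [::] T).
Proof. by case: T => //= r T []. Qed.

Lemma row_insert_gt0 x r : 0 < size (row_insert x r).
Proof. by rewrite size_row_insert; lia. Qed.

(** The entry [y] bumped from a row moves weakly to the left in the next one,
    because the entry below [y] is greater than [y].  So below the
    position of [x] and to its left the columns remain strict. *)
Lemma tab_insert_tableau x T : tableau T -> tableau (tab_insert x T).1.
Proof.
elim: T x => [|r T IHT] x //=.
move=> [r0 sr [dsz dnth] tT].
have lep := insert_pos_size x r.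
case: ifP => [ltp|gep] /=.
  move yE: (nth 0 r (insert_pos x r)) => y; have := IHT y tT.
  have := head_tab_insert y T.
  case: tab_insert => T1 i /= hT1 tT1; split=> //;
    [exact: row_insert_gt0|exact: row_insert_sorted|].
  have sr2 := tableau_head_sorted tT; rewrite hT1.
  move: (head [::] T) => r2 in dsz dnth sr2 *.
  have xy : x < y by rewrite ltnNge -yE insert_posP // ltnn.
  have p2 : insert_pos y r2 <= insert_pos x r.
    case: (ltnP (insert_pos x r) (size r2)) => [lt2|];
      last exact: leq_trans (insert_pos_size y r2).
    by have := dnth _ lt2; rewrite ltnNge insert_posP // yE -leqNgt.
  split=> [|j]; rewrite !size_row_insert; first lia.
  rewrite !nth_row_insert => ltj.
  case: eqP => [ej|nj]; case: eqP => [ej2|nj2] //.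
  - by apply: (ltn_trans xy); rewrite -yE -ej; apply: dnth; lia.
  - have : nth 0 r j <= x by rewrite insert_posP //; lia.
    by lia.
  - by apply: dnth; have := insert_pos_size y r2; lia.
split=> //; [exact: row_insert_gt0|exact: row_insert_sorted|].
split=> [|j ltj]; first by rewrite size_row_insert; lia.
rewrite nth_row_insert; case: eqP => [ej|nj]; last exact: dnth.
by lia.
Qed.

(** The column of the rightmost entry less than [y]; it is from there that
    [y] was bumped. *)
Definition eject_pos y r := (count (fun z => z < y) r).-1.

(** The inverse of [tab_insert]: the last box of row [i] is removed, and its
    entry bumps back an entry of each of the rows above. *)
Fixpoint tab_eject (i : nat) (T : seq (seq nat)) : nat * seq (seq nat) :=
  if T is r :: T' then
    if i is j.+1 then
      let: (y, T1) := tab_eject j T' in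
      (nth 0 r (eject_pos y r), set_nth 0 r (eject_pos y r) y :: T1)
    else (last 0 r, if size r == 1 then T' else take (size r).-1 r :: T')
  else (0, [::]).

Lemma ltn_countP y r j : sorted leq r -> j < size r ->
  (nth 0 r j < y) = (j < count (fun z => z < y) r).
Proof.
by move=> sr ltj; rewrite -(nth_sorted_count _ sr ltj) // => a b; exact: leq_ltn_trans.
Qed.

Lemma eq_initial_segment (P : pred nat) n c p : p <= n -> c <= n ->
  (forall j, j < n -> P j = (j < c)) -> (forall j, j < n -> P j = (j < p)) ->
  c = p.
Proof.
move=> lep lec Hc Hp; apply/eqP; rewrite eqn_leq; apply/andP; split; rewrite leqNgt;
  apply/negP => lt.
  by have := Hp p; rewrite Hc; lia.
by have := Hc c; rewrite Hp; lia.
Qed.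

Lemma eject_pos_row_insert x r : sorted leq r -> insert_pos x r < size r ->
  eject_pos (nth 0 r (insert_pos x r)) (row_insert x r) = insert_pos x r.
Proof.
move=> sr ltp; move yE: (nth 0 r _) => y.
have xy : x < y by rewrite ltnNge -yE insert_posP // ltnn.
rewrite /eject_pos;
  suff -> : count (fun z => z < y) (row_insert x r) = (insert_pos x r).+1 by [].
have sR := row_insert_sorted x sr; have szR := size_row_insert x r.
apply: (@eq_initial_segment (fun j =>
  nth 0 (row_insert x r) j < y) (size (row_insert x r))).
- lia.
- exact: count_size.
- by move=> j ltj; rewrite ltn_countP.
move=> j ltj; rewrite nth_row_insert; case: eqP => [->|nj]; first by rewrite xy; lia.
case: (ltnP j (insert_pos x r)) => ltjp.
  have : nth 0 r j <= x by rewrite insert_posP //; lia.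
  by lia.
have : y <= nth 0 r j by rewrite -yE; move/sorted_nthP: sr; apply; lia.
by lia.
Qed.

Lemma tab_insertK x T : tableau T -> tab_eject (tab_insert x T).2 (tab_insert x T).1 = (x, T).
Proof.
elim: T x => [|r T IHT] x //=.
move=> [r0 sr _ tT]; have lep := insert_pos_size x r.
case: ifP => [ltp|gep] /=.
  have := IHT (nth 0 r (insert_pos x r)) tT; case: tab_insert => T1 i /= ->.
  rewrite eject_pos_row_insert //; congr (_, _ :: _);
    first by rewrite nth_row_insert eqxx.
  by rewrite /row_insert set_set_nth eqxx; apply: (@eq_from_nth _ 0) => [|j _];
    [rewrite size_set_nth; lia | rewrite nth_set_nth /=; case: eqP => [->|]].
have pE : insert_pos x r = size r by lia.
have rE : row_insert x r = rcons r x by rewrite /row_insert set_nthE pE ltnn subnn cats1.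
rewrite rE last_rcons size_rcons /=; case: eqP => [|_]; first by case: (r) r0.
by rewrite -cats1 take_size_cat.
Qed.

Definition corner i (T : seq (seq nat)) :=
  size (nth [::] T i.+1) < size (nth [::] T i).

(** The induction on the number of rows needs to control how the first row
    changes, in order to restore the column condition with the row above: the
    entry leaving it comes from some column [p], no entry decreases, and all
    entries from column [p] on end up greater than the departing one. *)
Lemma tab_ejectK i T : tableau T -> corner i T ->
  [/\ tableau (tab_eject i T).2, tab_insert (tab_eject i T).1 (tab_eject i T).2 = (T, i) &
   exists p, [/\ p < size (head [::] T), (tab_eject i T).1 = nth 0 (head [::] T) p,
     size (head [::] (tab_eject i T).2) <= size (head [::] T),
     forall j, j < size (head [::] (tab_eject i T).2) ->
       nth 0 (head [::] T) j <= nth 0 (head [::] (tab_eject i T).2) j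
   & forall j, j < size (head [::] (tab_eject i T).2) -> p <= j ->
       (tab_eject i T).1 < nth 0 (head [::] (tab_eject i T).2) j]].
Proof.
elim: T i => [|r T IHT] [|i] //=; rewrite /corner /=.
  move=> [r0 sr [dsz dnth] tT]; rewrite nth0 => ltc.
  case: eqP => [sz1|nsz1].
    have T0 : T = [::] by case: (T) tT ltc => //= r2 T2 [? ? ? ?]; lia.
    case: r r0 sr dsz dnth ltc sz1 => [|a [|b r]] //= _ _ _ _ _ _.
    by rewrite T0; split=> //=; exists 0; split.
  have szr' : size (take (size r).-1 r) = (size r).-1 by rewrite size_take;
    case: ifP; lia.
  have nthr' j : j < (size r).-1 -> nth 0 (take (size r).-1 r) j = nth 0 r j by move=> ?; rewrite nth_take.
  have szp : (size r).-1.+1 = size r by lia.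
  have rE : r = rcons (take (size r).-1 r) (last 0 r).
    by rewrite (last_nth 0) -szp /= -take_nth; [rewrite szp take_size|lia].
  have lastE : last 0 r = nth 0 r (size r).-1 by rewrite nth_last.
  have rp : insert_pos (last 0 r) (take (size r).-1 r) = (size r).-1.
    rewrite -[RHS]szr'; apply/eqP; rewrite -all_count; apply/(all_nthP 0) => j.
    rewrite szr' => ltj; rewrite nthr' // lastE; move/sorted_nthP: sr; apply; lia.
  split=> /=.
  - split=> //; [lia|exact: take_sorted|].
    by split=> [|j ltj]; rewrite ?szr' ?nthr' //; [lia|exact: dnth|lia].
  - rewrite rp szr' ltnn /row_insert set_nthE rp szr' ltnn subnn /= cats1 -rE //.
  - exists (size r).-1; split; rewrite ?szr' //; try lia.
    by move=> j ltj; rewrite nthr'.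
move=> [r0 sr [dsz dnth] tT] ltc.
have {IHT} := IHT i tT ltc;
  case: tab_eject => y T1 /= [tT1 insT [p2 [ltp2 yE sz2 le2 gt2]]].
set q := eject_pos y r.
have ltp2r : p2 < count (fun z => z < y) r by rewrite -ltn_countP ?yE;
  [exact: dnth|by []|lia].
have csz := count_size (fun z => z < y) r.
have [p2q ltq] : p2 <= q /\ q < size r by rewrite /q /eject_pos; lia.
have qc : count (fun z => z < y) r = q.+1 by rewrite /q /eject_pos; lia.
have qy : nth 0 r q < y by rewrite ltn_countP // qc.
have sz' : size (set_nth 0 r q y) = size r by rewrite size_set_nth; lia.
have gty j : j < size r -> q < j -> y <= nth 0 r j.
  by move=> ltj ltqj; rewrite leqNgt ltn_countP // qc; lia.
have leq_ j : j <= q -> nth 0 r j <= nth 0 r q by move=> lej; move/sorted_nthP: sr;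
  apply; lia.
have s' : sorted leq (set_nth 0 r q y).
  apply/sorted_nthP => a b leab; rewrite sz' !nth_set_nth /= => ltb.
  case: (a =P q) => [ea|na]; case: (b =P q) => [eb|nb] //.
  - by apply: gty; lia.
  - by apply: leq_trans (ltnW qy); apply: leq_; lia.
  - by move/sorted_nthP: sr; apply.
have rp : insert_pos (nth 0 r q) (set_nth 0 r q y) = q.
  apply: (@eq_initial_segment (fun j =>
    nth 0 (set_nth 0 r q y) j <= nth 0 r q) (size r)).
  - lia.
  - by rewrite -sz' insert_pos_size.
  - by move=> j ltj; rewrite insert_posP // sz'.
  - move=> j ltj; rewrite nth_set_nth /=; case: eqP => [->|nj]; first lia.
    case: (ltnP j q) => ltjq; first by rewrite leq_ //; lia.
    by have := gty j ltj; lia.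
split=> /=.
- split=> //; first lia.
  split=> [|j ltj]; rewrite ?sz'; first lia.
  rewrite nth_set_nth /=; case: eqP => [ej|nj]; first by apply: gt2; lia.
  by apply: leq_trans (le2 _ ltj); apply: dnth; lia.
- rewrite rp sz' ltq nth_set_nth /= eqxx insT /row_insert rp set_set_nth eqxx.
  congr (_ :: _, _); apply: (@eq_from_nth _ 0) => [|j _];
    first by rewrite size_set_nth; lia.
  by rewrite nth_set_nth /=; case: eqP => [->|].
- exists q; split; rewrite ?sz' // => j ltj; rewrite nth_set_nth /=;
  case: eqP => [->|nj] //.
    exact: ltnW.
  move=> leqj; apply: leq_trans qy _; apply: gty; lia.
Qed.

(** * The Robinson-Schensted-Knuth correspondence *)

Definition rsk_step (s : seq (seq nat) * seq nat) x :=
  ((tab_insert x s.1).1, rcons s.2 (tab_insert x s.1).2).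
(** The recording tableau is replaced by the word of the row indices of the
    successive new boxes. *)
Definition rsk (u : seq nat) := foldl rsk_step ([::], [::]) u.

Lemma rsk_rcons u x : rsk (rcons u x) = rsk_step (rsk u) x.
Proof. by rewrite /rsk -cats1 foldl_cat. Qed.

Lemma rsk_tableau u : tableau (rsk u).1.
Proof. by elim/last_ind: u => [//|u x IHu]; rewrite rsk_rcons;
  exact: tab_insert_tableau. Qed.

Lemma size_tab_insert x T i :
  size (nth [::] (tab_insert x T).1 i) = ((tab_insert x T).2 == i) + size (nth [::] T i).
Proof.
elim: T x i => [|r T IHT] x i; first by case: i => [|[|i]]; rewrite //= ?nth_nil.
rewrite /=; have lep := insert_pos_size x r; have := size_row_insert x r.
case: ifP => ltp; last by case: i => [|i] //=; lia.
have {IHT} := IHT (nth 0 r (insert_pos x r)); case: tab_insert => T1 k /= IHT.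
by case: i => [|i] /=; [lia|rewrite IHT eqSS].
Qed.

Lemma size_rsk u i : size (nth [::] (rsk u).1 i) = count_mem i (rsk u).2.
Proof.
elim/last_ind: u => [|u x IHu]; first by rewrite nth_nil.
by rewrite rsk_rcons /= size_tab_insert IHu -cats1 count_cat /= addn0 addnC.
Qed.

Lemma tableau_size T i : tableau T -> size (nth [::] T i.+1) <= size (nth [::] T i).
Proof.
elim: T i => [|r T IHT] [|i] //= [_ _ [le _] tT]; first by rewrite nth0.
exact: IHT.
Qed.

Definition nonincr (c : nat -> nat) := forall i, c i.+1 <= c i.
(** The row words of standard tableaux: every prefix contains [i] at least as
    often as [i + 1], so that it describes a partition. *)
Definition yamanouchi (y : seq nat) :=
  forall j, nonincr (fun i => count_mem i (take j y)).

Lemma yamanouchi_rcons y i :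
  yamanouchi (rcons y i) <-> yamanouchi y /\ nonincr (fun r => count_mem r (rcons y i)).
Proof.
split=> [Y|[Y L] j r].
  split=> [j r|r]; last by have := Y (size y).+1 r; rewrite -(size_rcons y i) take_size.
  have := Y (minn j (size y)) r; rewrite -cats1 takel_cat ?geq_minr //.
  by rewrite /minn; case: ltnP => // lej; rewrite take_size [take j y]take_oversize.
case: (leqP j (size y)) => lej; first by rewrite -cats1 takel_cat //; exact: Y.
by rewrite take_oversize ?size_rcons //; exact: L.
Qed.

Lemma yamanouchi_nonincr y : yamanouchi y -> nonincr (fun i => count_mem i y).
Proof. by move=> Y i; have := Y (size y) i; rewrite take_size. Qed.

Lemma rsk_yamanouchi u : yamanouchi (rsk u).2.
Proof.
elim/last_ind: u => [|u x IHu]; first by move=> j i.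
rewrite rsk_rcons /=; apply/yamanouchi_rcons; split=> // i.
have := @tableau_size (rsk (rcons u x)).1 i (rsk_tableau _).
by rewrite !size_rsk rsk_rcons.
Qed.

Lemma rsk_inj : injective rsk.
Proof.
elim/last_ind => [|u x IHu]; elim/last_ind => [|v z _] //.
- by rewrite rsk_rcons => -[_]; case: (rsk v).2.
- by rewrite rsk_rcons => -[_]; case: (rsk u).2.
rewrite !rsk_rcons => -[eqT /rcons_inj [eqY eqi]].
have := tab_insertK x (rsk_tableau u); rewrite eqT eqi tab_insertK;
  last exact: rsk_tableau.
move=> [-> eqP]; congr rcons; apply: IHu.
by rewrite [LHS]surjective_pairing [RHS]surjective_pairing eqY eqP.
Qed.

(** The last letter of [y] tells from which corner to eject. *)
Lemma rsk_surj T y : tableau T -> yamanouchi y ->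
  (forall i, size (nth [::] T i) = count_mem i y) -> exists u, rsk u = (T, y).
Proof.
elim/last_ind: y T => [|y i IHy] T tT Yy szT.
  exists [::]; congr pair; case: T tT szT => //= r T [r0 _ _ _] /(_ 0) /=; lia.
have [Yy' L] := (yamanouchi_rcons y i).1 Yy.
have cnt r : count_mem r (rcons y i) = (i == r) + count_mem r y.
  by rewrite -cats1 count_cat /= addn0 addnC.
have cT : corner i T.
  rewrite /corner !szT !cnt eqxx.
  by have := yamanouchi_nonincr Yy' i; case: eqP; lia.
have [tT' insT _] := tab_ejectK tT cT.
have [r|u uE] := IHy (tab_eject i T).2 tT' Yy'.
  have := szT r; rewrite cnt.
  by have := size_tab_insert (tab_eject i T).1 (tab_eject i T).2 r; rewrite insT /=;
    lia.
by exists (rcons u (tab_eject i T).1); rewrite rsk_rcons uE /rsk_step /= insT.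
Qed.

Lemma tab_insert_perm x T : perm_eq (flatten (tab_insert x T).1) (x :: flatten T).
Proof.
elim: T x => [|r T IHT] x //=.
have := row_insert_perm x r; case: ifP => _ pr; last by rewrite /= -cat_cons perm_cat2r.
have := IHT (nth 0 r (insert_pos x r)); case: tab_insert => T1 i /= pT.
rewrite (perm_trans (y := row_insert x r ++ nth 0 r (insert_pos x r) :: flatten T)) ?perm_cat2l //.
by rewrite -cat1s perm_catCA cat1s -cat_cons -cat_cons perm_cat2r.
Qed.

Lemma rsk_perm u : perm_eq (flatten (rsk u).1) u.
Proof.
elim/last_ind: u => [|u x IHu] //.
rewrite rsk_rcons perm_sym perm_rcons perm_sym.
by apply: perm_trans (tab_insert_perm _ _) _; rewrite perm_cons.
Qed.

(** * The first row and increasing subsequences *)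

Definition row1 (u : seq nat) := foldl (fun r x => row_insert x r) [::] u.

Lemma row1_rcons u x : row1 (rcons u x) = row_insert x (row1 u).
Proof. by rewrite /row1 -cats1 foldl_cat. Qed.

Lemma row1_sorted u : sorted leq (row1 u).
Proof. by elim/last_ind: u => [//|u x IHu]; rewrite row1_rcons row_insert_sorted. Qed.

Lemma head_rsk u : head [::] (rsk u).1 = row1 u.
Proof. by elim/last_ind: u => [//|u x IHu];
  rewrite rsk_rcons row1_rcons head_tab_insert IHu. Qed.

(** Inserting [z] lowers one entry of the row; this changes the number of
    entries at most [x] only if [z <= x], and then the first [insert_pos z r + 1]
    entries are at most [z]. *)
Lemma insert_pos_row_insert x z r : sorted leq r ->
  insert_pos x (row_insert z r) =
  if z <= x then maxn (insert_pos z r).+1 (insert_pos x r) else insert_pos x r.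
Proof.
move=> sr; have sz := size_row_insert z r; have lz := insert_pos_size z r.
have lx := insert_pos_size x r.
have szx := insert_pos_size x (row_insert z r).
have mono a b : a <= b -> insert_pos a r <= insert_pos b r.
  by move=> leab; apply: sub_count => c /= /leq_trans; apply.
apply: (@eq_initial_segment (fun j =>
  nth 0 (row_insert z r) j <= x) (size (row_insert z r))) => //.
- by case: ifP => _; lia.
- by move=> j ltj; rewrite insert_posP // row_insert_sorted.
move=> j ltj; rewrite nth_row_insert; case: (leqP z x) => lezx.
  case: eqP => [->|nj]; first by rewrite lezx; lia.
  have ltjr : j < size r by lia.
  by rewrite insert_posP //; have := mono _ _ lezx; lia.
have lexz := mono _ _ (ltnW lezx).
by case: eqP => [->|nj]; [lia|rewrite insert_posP //; lia].
Qed.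

Lemma sorted_rcons2 (s : seq nat) a b :
  sorted leq (rcons (rcons s a) b) = sorted leq (rcons s a) && (a <= b).
Proof. by case: s => [|c s] /=; [rewrite andbT|rewrite rcons_path last_rcons]. Qed.

(** Schensted's theorem: the letters of the first row at most [x] count the
    longest weakly increasing subsequence of [u] to which [x] can be appended. *)
Lemma increasing_subseq_row1 u x j :
  (exists s, [/\ subseq s u, size s = j & sorted leq (rcons s x)]) <->
  j <= insert_pos x (row1 u).
Proof.
elim/last_ind: u x j => [|u z IHu] x j.
  split=> [[s [/eqP -> <- _]] //|]; rewrite leqn0 => /eqP ->.
  by exists [::].
rewrite row1_rcons insert_pos_row_insert ?row1_sorted //.
split=> [[s [sub szs srt]]|].
  case/lastP: s sub szs srt => [_ <- //|s a].
  rewrite size_rcons => sub <- srt.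
  have [ea|na] := eqVneq a z; last first.
    have : subseq (rcons s a) u.
      move: sub; rewrite -subseq_rev !rev_rcons /= (negbTE na) -(subseq_rev (rcons s a)).
      by rewrite rev_rcons.
    move=> sub'; have : (size s).+1 <= insert_pos x (row1 u).
      by apply/IHu; exists (rcons s a); rewrite size_rcons.
    by case: ifP => _; lia.
  move: srt; rewrite sorted_rcons2 ea => /andP[srt ->].
  have : size s <= insert_pos z (row1 u); last by lia.
  apply/IHu; exists s; split=> //.
  by move: sub; rewrite -subseq_rev !rev_rcons ea /= eqxx subseq_rev.
case: (leqP z x) => [lezx|_]; last first.
  by move/IHu => [s [sub ss srt]]; exists s; split=> //;
    apply: subseq_trans sub (subseq_rcons _ _).
case: (leqP j (insert_pos x (row1 u))) => [|ltj lej].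
  by move=> /IHu [s [sub ss srt]] _; exists s; split=> //;
    apply: subseq_trans sub (subseq_rcons _ _).
case: j => [|j] in ltj lej *; first by exists [::]; split.
have /IHu [s [sub ss srt]] : j <= insert_pos z (row1 u) by lia.
exists (rcons s z); split; rewrite ?size_rcons ?ss ?sorted_rcons2 ?srt //.
by rewrite -!cats1 cat_subseq.
Qed.

(** The length of the longest weakly increasing subsequence ending at
    position [p], in view of [increasing_subseq_row1]. *)
Definition rank (u : seq nat) p := (insert_pos (nth 0 u p) (row1 (take p u))).+1.

Lemma rank_rcons u x p : p < size u -> rank (rcons u x) p = rank u p.
Proof.
by move=> ltp; rewrite /rank nth_rcons ltp -cats1 takel_cat // ltnW.
Qed.

Lemma rank_last u x : rank (rcons u x) (size u) = (insert_pos x (row1 u)).+1.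
Proof. by rewrite /rank nth_rcons ltnn eqxx -cats1 take_size_cat. Qed.

Lemma insert_pos_mono x y r : x <= y -> insert_pos x r <= insert_pos y r.
Proof. by move=> lexy; apply: sub_count => c /= /leq_trans; apply. Qed.

Lemma insert_pos_row1_rcons x u z : insert_pos x (row1 u) <= insert_pos x (row1 (rcons u z)).
Proof.
by rewrite row1_rcons insert_pos_row_insert ?row1_sorted //; case: ifP => _; lia.
Qed.

Lemma rank_le u p z : p < size u -> nth 0 u p <= z -> rank u p <= insert_pos z (row1 u).
Proof.
elim/last_ind: u => [//|u x IHu]; rewrite size_rcons ltnS leq_eqVlt.
case/orP => [/eqP ->|ltp].
  rewrite rank_last nth_rcons ltnn eqxx row1_rcons => lexz.
  by rewrite insert_pos_row_insert ?row1_sorted // lexz; lia.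
rewrite rank_rcons // nth_rcons ltp => /(IHu ltp) le.
exact: leq_trans le (insert_pos_row1_rcons _ _ _).
Qed.

(** The entry in column [j] of the first row is the latest letter of rank
    [j + 1]. *)
Lemma rank_ex u j : j < size (row1 u) ->
  exists p, [/\ p < size u, rank u p = j.+1 & nth 0 u p = nth 0 (row1 u) j].
Proof.
elim/last_ind: u => [//|u x IHu].
rewrite row1_rcons size_row_insert nth_row_insert => ltj.
case: eqP => [->|nj].
  by exists (size u); rewrite size_rcons nth_rcons ltnn eqxx rank_last.
have lp := insert_pos_size x (row1 u).
have [|p [ltp rp np]] := IHu; first lia.
by exists p; rewrite size_rcons nth_rcons ltp rank_rcons //; split=> //; lia.
Qed.

Lemma rank_ex_le u j z : 0 < j -> j <= insert_pos z (row1 u) ->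
  exists p, [/\ p < size u, rank u p = j & nth 0 u p <= z].
Proof.
case: j => [//|j] _ lej; have lz := insert_pos_size z (row1 u).
have ltj : j < size (row1 u) by lia.
have [p [ltp rp np]] := rank_ex ltj; exists p; split=> //.
by rewrite np insert_posP // row1_sorted.
Qed.

Lemma rank_size u p : p < size u -> rank u p <= size (row1 u).
Proof.
by move=> ltp; apply: leq_trans (rank_le ltp (leqnn _)) (insert_pos_size _ _).
Qed.

(** * Two classes of words *)

Lemma last_row1 u x : size (row1 u) <= insert_pos x (row1 u) -> u != [::] ->
  last 0 u <= x.
Proof.
case/lastP: u => [//|u z]; rewrite last_rcons row1_rcons => H _.
have lz := insert_pos_size z (row1 u); have sz := size_row_insert z (row1 u).
have <- : nth 0 (row_insert z (row1 u)) (insert_pos z (row1 u)) = z by rewrite nth_row_insert eqxx.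
by rewrite insert_posP ?row_insert_sorted ?row1_sorted //; lia.
Qed.

(** This is the condition on [u] equivalent to avoidance of [Pi_k2 k] by its
    standardization. *)
Definition rising_tail k (u : seq nat) := forall p q, p < q -> q < size u ->
  k < rank u p -> nth 0 u p <= nth 0 u q.

(** This is the condition on [u] equivalent to avoidance of [Pi_k1 k] by its
    standardization: after a letter [u_p] of rank at least [k], the word is
    weakly increasing as long as letters at least [u_p] remain. *)
Definition rising_runs k (u : seq nat) := forall p q r, p < q -> q < r -> r < size u ->
  k <= rank u p -> nth 0 u p <= nth 0 u r ->
  nth 0 u p <= nth 0 u q <= nth 0 u r.

(** A letter [x] may be added when it is at least as large as the whole first
    row, as soon as that row is longer than [k].  Indeed the last letter of [u]
    lies in the first row and dominates all letters of rank above [k]. *)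
Lemma rising_tail_rcons k u x : rising_tail k (rcons u x) <->
  rising_tail k u /\ (k < size (row1 u) -> size (row1 u) <= insert_pos x (row1 u)).
Proof.
split=> [W|[W H] p q].
  split=> [p q ltpq ltq|ltk].
    have := W p q ltpq; rewrite size_rcons !nth_rcons ltq (ltn_trans ltpq ltq).
    by rewrite rank_rcons //; [apply; lia|lia].
  rewrite leqNgt; apply/negP => ltx.
  (* Otherwise the last entry of the first row, of rank above [k], exceeds [x]. *)
  have ltl : (size (row1 u)).-1 < size (row1 u) by lia.
  have [p [ltp rp np]] := rank_ex ltl.
  have := W p (size u) ltp;
    rewrite size_rcons !nth_rcons ltp ltnn eqxx rank_rcons // rp.
  have -> : (size (row1 u)).-1.+1 = size (row1 u) by lia.
  by move=> /(_ (leqnn _) ltk); rewrite np insert_posP ?row1_sorted //; lia.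
rewrite size_rcons ltnS => ltpq leq; have ltp : p < size u by lia.
rewrite rank_rcons // !nth_rcons ltp; move: leq; rewrite leq_eqVlt.
case/orP => [/eqP eq|ltq kr]; last by rewrite ltq; apply: W.
rewrite eq ltnn eqxx => kr.
have kl : k < size (row1 u) by apply: leq_trans kr (rank_size ltp).
have {}H := H kl.
have ler : nth 0 u p <= last 0 u.
  rewrite -nth_last; have [->//|np] := eqVneq p (size u).-1.
  by apply: W; lia.
apply: leq_trans ler (last_row1 H _).
by rewrite -size_eq0 -lt0n (leq_ltn_trans (leq0n p)).
Qed.

(** Once the first row is longer than [k], only the first row grows. *)
Definition zeros_beyond k (y : seq nat) := forall j, j < size y ->
  k < count_mem 0 (take j y) -> nth 0 y j = 0.

Lemma zeros_beyond_rcons k y i : zeros_beyond k (rcons y i) <-> zeros_beyond k y /\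
  (k < count_mem 0 y -> i = 0).
Proof.
split=> [Y|[Y H] j]; last first.
  rewrite size_rcons ltnS leq_eqVlt => /orP[/eqP ->|ltj].
    by rewrite -cats1 take_size_cat // nth_cat ltnn subnn.
  by rewrite nth_rcons ltj -cats1 takel_cat ?(ltnW ltj) //; exact: Y.
split=> [j ltj|].
  have := Y j; rewrite size_rcons nth_rcons ltj -cats1 takel_cat ?(ltnW ltj) //.
  by apply; lia.
have := Y (size y); rewrite size_rcons -cats1 take_size_cat // nth_cat ltnn subnn /=.
by apply.
Qed.

Lemma rising_tail_rsk k u : rising_tail k u <-> zeros_beyond k (rsk u).2.
Proof.
elim/last_ind: u => [|u x IHu]; first by split=> // _ p q; rewrite ltn0.
rewrite rising_tail_rcons rsk_rcons /= zeros_beyond_rcons IHu -size_rsk nth0 head_rsk.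
suff -> : ((tab_insert x (rsk u).1).2 = 0) <-> size (row1 u) <= insert_pos x (row1 u) by [].
rewrite -head_rsk; case: (rsk u).1 => //= r T.
by case: ltnP => // _; case: tab_insert.
Qed.

(** * A content-preserving bijection between the two classes *)

(** The state is the pair formed by the letters of rank at most [k] and by the
    other ones, each in order of appearance.  Ranks can be computed in the
    former word only, by [row1_low_high]. *)
Definition low_high_step k (s : seq nat * seq nat) x :=
  if insert_pos x (row1 s.1) < k then (rcons s.1 x, s.2) else (s.1, rcons s.2 x).
Definition low_high k u := foldl (low_high_step k) ([::], [::]) u.

Lemma low_high_rcons k u x : low_high k (rcons u x) = low_high_step k (low_high k u) x.
Proof. by rewrite /low_high -cats1 foldl_cat. Qed.

Lemma insert_pos_take k x r : sorted leq r -> insert_pos x (take k r) = minn k (insert_pos x r).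
Proof.
move=> sr; have lx := insert_pos_size x r; have := size_take_min k r => szt.
have szt' := insert_pos_size x (take k r).
apply: (@eq_initial_segment (fun j => nth 0 (take k r) j <= x) (size (take k r))) => //.
- by lia.
- by move=> j ltj; rewrite insert_posP // take_sorted.
by move=> j ltj; rewrite nth_take ?insert_posP //; lia.
Qed.

(** Letters of rank above [k] never influence the first [k] columns. *)
Lemma row1_low_high k u : row1 (low_high k u).1 = take k (row1 u).
Proof.
elim/last_ind: u => [//|u x IHu].
rewrite low_high_rcons row1_rcons /low_high_step IHu insert_pos_take ?row1_sorted //.
move: (row1 u) (row1_sorted u) IHu => r sr IHu; have lx := insert_pos_size x r.
have szr := size_row_insert x r; have szt := size_row_insert x (take k r).
have sz1 := size_take_min k r; have sz2 := size_take_min k (row_insert x r).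
have pt := insert_pos_take k x sr.
case: ifP => lt /=; rewrite ?row1_rcons IHu; apply: (@eq_from_nth _ 0) => [|j ltj];
  try lia.
  have pE : insert_pos x (take k r) = insert_pos x r by lia.
  have ltjk : j < k by lia.
  by rewrite nth_take // !nth_row_insert pE nth_take.
rewrite !nth_take ?nth_row_insert; try lia.
by case: eqP => // ej; lia.
Qed.

Lemma low_high_perm k u : perm_eq ((low_high k u).1 ++ (low_high k u).2) u.
Proof.
elim/last_ind: u => [//|u x IHu]; rewrite low_high_rcons /low_high_step.
rewrite perm_sym perm_rcons; case: ifP => _ /=.
  rewrite cat_rcons perm_sym -cat1s perm_catCA cat1s perm_cons; exact: IHu.
by rewrite -rcons_cat perm_sym perm_rcons perm_cons.
Qed.

(** The letter [z] has rank above [k] after the word [v]. *)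
Definition high k v z := k <= insert_pos z (row1 v).

Lemma high_rcons k v x z : high k v z -> high k (rcons v x) z.
Proof. by move=> /leq_trans; apply; exact: insert_pos_row1_rcons. Qed.

Lemma low_high_all_high k u : all (high k (low_high k u).1) (low_high k u).2.
Proof.
elim/last_ind: u => [//|u x IHu]; rewrite low_high_rcons /low_high_step.
case: ifP => lt /=; first by apply: sub_all IHu => z; exact: high_rcons.
by rewrite all_rcons IHu andbT /high leqNgt lt.
Qed.

Lemma size_row1_low_high k u : size (row1 (low_high k u).1) <= k.
Proof. by rewrite row1_low_high size_take_min geq_minl. Qed.

Lemma rank_cat u v p : p < size u -> rank (u ++ v) p = rank u p.
Proof.
by move=> ltp; rewrite /rank nth_cat ltp takel_cat // ltnW.
Qed.

Lemma low_high_size k u : (low_high k u).2 != [::] -> k < size (row1 u).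
Proof.
elim/last_ind: u => [//|u x IHu]; rewrite low_high_rcons /low_high_step.
have lx := insert_pos_size x (row1 u); have := size_row_insert x (row1 u).
rewrite row1_rcons row1_low_high insert_pos_take ?row1_sorted //.
by case: ifP => /= lt sz; [move/IHu; lia|lia].
Qed.

(** A letter of rank above [k] makes the first row longer than [k]; from then
    on each new letter is at least as large as that row, hence has rank
    above [k] too and is at least as large as its predecessor. *)
Lemma rising_tail_low_high k u : rising_tail k u ->
  u = (low_high k u).1 ++ (low_high k u).2 /\ sorted leq (low_high k u).2.
Proof.
elim/last_ind: u => [//|u x IHu] /rising_tail_rcons [/IHu [uE sU] H].
have big := @low_high_size k u; have r1 := row1_low_high k u.
rewrite low_high_rcons /low_high_step; case: ifP => lt /=.
  have U0 : (low_high k u).2 = [::].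
    apply/eqP; apply: contraLR lt => /big ltk; rewrite -leqNgt r1.
    by rewrite insert_pos_take ?row1_sorted //; have := H ltk; lia.
  by rewrite {1}uE U0 !cats0.
split; first by rewrite -rcons_cat -uE.
case/lastP: (low_high k u).2 uE sU big => [//|U z] uE sU big.
have ltk : k < size (row1 u) by apply: big; case: (U).
have u0 : u != [::] by rewrite uE -rcons_cat -size_eq0 size_rcons.
have := last_row1 (H ltk) u0; rewrite uE -rcons_cat last_rcons.
by move: sU; case: (U) => [|a U'] /=; rewrite ?andbT // !rcons_path last_rcons => -> ->.
Qed.

Lemma low_high_small k v : size (row1 v) <= k -> low_high k v = (v, [::]).
Proof.
elim/last_ind: v => [//|v x IHv]; rewrite row1_rcons size_row_insert => sz.
by rewrite low_high_rcons IHv ?/low_high_step; [case: ifP => //=; lia|lia].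
Qed.

Lemma low_high_cat k u v U L : low_high k u = (v, U) -> all (high k v) L ->
  low_high k (u ++ L) = (v, U ++ L).
Proof.
move=> splu; elim/last_ind: L => [|L z IHL]; first by rewrite !cats0.
rewrite all_rcons => /andP[hz /IHL {}IHL].
by rewrite -!rcons_cat low_high_rcons IHL /low_high_step /= ltnNge -/(high k v z) hz.
Qed.

Lemma rising_tail_cat k v U : size (row1 v) <= k -> sorted leq U -> rising_tail k (v ++ U).
Proof.
move=> szv sU p q ltpq; rewrite size_cat => ltq.
case: (ltnP p (size v)) => ltp.
  by rewrite rank_cat // => /leq_trans /(_ (rank_size ltp)); lia.
have geq : size v <= q by lia.
move=> _; rewrite !nth_cat ltnNge ltp ltnNge geq /=.
by move/sorted_nthP: sU; apply; lia.
Qed.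

(** Arranges the letters [U] of rank above [k] within the word [v], which is
    passed in reverse order.  A letter of rank exactly [k] is followed by the
    letters of [U] that could not have had rank above [k] before it. *)
Fixpoint merge_runs_rev k (rv U : seq nat) :=
  if rv is x :: rv' then
    let v := rev rv' in
    if (insert_pos x (row1 v)).+1 == k then
      merge_runs_rev k rv' (filter (high k v) U) ++ x :: filter (predC (high k v)) U
    else rcons (merge_runs_rev k rv' U) x
  else [::].
Definition merge_runs k v U := merge_runs_rev k (rev v) U.

Lemma merge_runs_rcons k v x U : merge_runs k (rcons v x) U =
  if (insert_pos x (row1 v)).+1 == k then
    merge_runs k v (filter (high k v) U) ++ x :: filter (predC (high k v)) U
  else rcons (merge_runs k v U) x.
Proof. by rewrite /merge_runs rev_rcons /= revK. Qed.

(** The letters of [x :: L] are smaller than every letter of [u] of rank at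
    least [k], so that no condition involves both parts. *)
Lemma rising_runs_cat k u x L : rising_runs k u -> sorted leq (x :: L) ->
  (forall z, z \in x :: L -> ~~ high k u z) -> rising_runs k (u ++ x :: L).
Proof.
move=> Wu sL lo p q r ltpq ltqr; rewrite size_cat => ltr.
have [ltp|gep] := ltnP p (size u).
  rewrite rank_cat //; have [ltru|geru] := ltnP r (size u).
    have ltq : q < size u by lia.
    by rewrite !nth_cat ltp ltq ltru; exact: Wu.
  move=> kr; rewrite [X in X <= _]nth_cat ltp [X in _ <= X]nth_cat ltnNge geru /= => le.
  have /lo/negP[] : nth 0 (x :: L) (r - size u) \in x :: L by rewrite mem_nth // ltn_subLR.
  exact: leq_trans kr (rank_le ltp le).
have [geq ger] : size u <= q /\ size u <= r by lia.
move=> _ _; rewrite !nth_cat ltnNge gep ltnNge geq ltnNge ger.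
by apply/andP; split; move/sorted_nthP: sL; apply; lia.
Qed.

Lemma high_low_high k u z : high k u z = high k (low_high k u).1 z.
Proof. by rewrite /high row1_low_high insert_pos_take ?row1_sorted //; lia. Qed.

Lemma high_rcons_low k v x z : (insert_pos x (row1 v)).+1 < k ->
  high k (rcons v x) z -> high k v z.
Proof.
by move=> lt; rewrite /high row1_rcons insert_pos_row_insert ?row1_sorted //;
  case: ifP => _; lia.
Qed.

Lemma high_rcons_ge k v x z : (insert_pos x (row1 v)) < k ->
  high k (rcons v x) z -> x <= z.
Proof.
move=> lt; rewrite /high row1_rcons insert_pos_row_insert ?row1_sorted //.
by case: (leqP x z) => // lt2; have := insert_pos_mono (row1 v) (ltnW lt2); lia.
Qed.

(** At a letter [x] of rank [k], the letters of [U] that are not high before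
    [x] are at least [x], and they form with [x] a sorted run to which
    [rising_runs_cat] applies. *)
Lemma merge_runs_spec k v U : 0 < k -> size (row1 v) <= k -> all (high k v) U -> sorted leq U ->
  [/\ rising_runs k (merge_runs k v U), (low_high k (merge_runs k v U)).1 = v
    & perm_eq (low_high k (merge_runs k v U)).2 U].
Proof.
move=> k0; elim/last_ind: v U => [|v x IHv] U szv hU sU.
  case: U hU sU => [_ _|z U]; last by rewrite /= /high /insert_pos /= leqNgt k0.
  by split=> // p q r; rewrite ltn0.
have {}szv : size (row1 v) <= k /\ insert_pos x (row1 v) < k.
  by move: szv; rewrite row1_rcons size_row_insert; lia.
case: szv => szv lox; rewrite merge_runs_rcons; case: eqP => [rx|nrx].
  have [|||W' s1 s2] := IHv (filter (high k v) U) => //; first exact: filter_all.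
    exact: sorted_filter leq_trans _ _ sU.
  set u' := merge_runs k v _ in W' s1 s2 *.
  have splx : low_high k (rcons u' x) = (rcons v x, (low_high k u').2).
    by rewrite low_high_rcons /low_high_step s1 lox.
  have allL : all (high k (rcons v x)) (filter (predC (high k v)) U).
    by apply/allP => z; rewrite mem_filter => /andP[_ /(allP hU)].
  rewrite -cat_rcons (low_high_cat splx allL) /= cat_rcons; split=> //.
    apply: rising_runs_cat => // [|z].
      rewrite /= path_min_sorted; first exact: sorted_filter leq_trans _ _ sU.
      by apply: sub_all allL => z; exact: high_rcons_ge.
    rewrite inE => /orP[/eqP ->|]; first by rewrite high_low_high s1 /high; lia.
    by rewrite mem_filter high_low_high s1 /= => /andP[].
  rewrite (perm_trans (perm_cat s2 (perm_refl _))) //.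
  by rewrite perm_filterC.
have hU' : all (high k v) U by apply: sub_all hU => z; apply: high_rcons_low; lia.
have [W' s1 s2] := IHv U szv hU' sU.
rewrite low_high_rcons /low_high_step s1 lox /=; split=> //.
rewrite -cats1; apply: rising_runs_cat => // z; rewrite inE => /eqP ->.
by rewrite high_low_high s1 /high; lia.
Qed.

Lemma rising_runs_belast k u x : rising_runs k (rcons u x) -> rising_runs k u.
Proof.
move=> W p q r ltpq ltqr ltr; have := W p q r ltpq ltqr.
have [ltq ltp] : q < size u /\ p < size u by lia.
rewrite size_rcons rank_rcons // !nth_rcons ltp ltq ltr; apply; lia.
Qed.

(** If [x] had rank above [k] relatively to [u], some letter of [u] of
    rank [k] would be at most [x]; the whole word from there to [x] would be at
    least this letter, and [p] would be high. *)
Lemma rising_runs_next_low k u p L x : 0 < k -> rising_runs k (rcons (u ++ p :: L) x) ->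
  ~~ high k u p -> ~~ high k u x.
Proof.
move=> k0 W; apply: contra => /(rank_ex_le k0) [r [ltr rr lerx]].
have := W r (size u) (size (u ++ p :: L)).
rewrite rcons_cat rank_cat // !size_cat size_rcons !nth_cat ltr ltnn subnn /=.
rewrite [_ + _ < size u]ltnNge leq_addr /= addKn /= nth_rcons ltnn eqxx rr.
move=> /(_ isT) H; have [||||le _] := andP (H _ _ _ _) => //; try lia.
by rewrite /high -rr; exact: rank_le ltr le.
Qed.

Lemma rising_runs_next_ge k u p L x : rising_runs k (rcons (u ++ p :: L) x) ->
  k <= (insert_pos p (row1 u)).+1 -> p <= x -> all (leq^~ x) L.
Proof.
move=> W kp lepx; apply/(all_nthP 0) => j ltj.
have := W (size u) (size u + j.+1) (size (u ++ p :: L)).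
rewrite rcons_cat {1}/rank take_size_cat // !size_cat size_rcons !nth_cat ltnn subnn /=.
rewrite ![_ + _ < size u]ltnNge !leq_addr /= !addKn /= !nth_rcons ltnn eqxx ltj.
by move=> H; have [|||||_ le] := andP (H _ _ _ _ _) => //; lia.
Qed.

(** By induction on the word: a new letter [x] of rank above [k] must directly
    follow the run that it belongs to.  Otherwise the last letter before [x], or
    the letter of rank [k] starting the current run, contradicts
    [rising_runs_next_low]. *)
Lemma rising_runs_merge k u : 0 < k -> rising_runs k u ->
  u = merge_runs k (low_high k u).1 (sort leq (low_high k u).2).
Proof.
move=> k0; elim/last_ind: u => [//|u x IHu] W.
have {IHu} uE := IHu (rising_runs_belast W).
have hU := low_high_all_high k u; have szv := size_row1_low_high k u.
rewrite low_high_rcons /low_high_step; set v := (low_high k u).1 in uE hU szv *.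
set U := (low_high k u).2 in uE hU *.
have hS : all (high k v) (sort leq U) by rewrite all_sort.
case: ifP => [lox|/negbT]; last rewrite -leqNgt -/(high k v x).
  rewrite merge_runs_rcons /= -/v -/U; case: eqP => _; last by rewrite -uE.
  have -> : filter (high k v) (sort leq U) = sort leq U by apply/all_filterP.
  rewrite -uE -cats1; congr (_ ++ _ :: _).
  by apply/esym/eqP; rewrite -[_ == _]negbK -has_filter has_predC negbK.
move=> hix; rewrite [merge_runs _ _ _]/=.
have hux : high k u x by rewrite high_low_high.
have sS : sorted leq (sort leq U) by exact: sort_sorted leq_total _.
move: uE hU szv hS hix; rewrite -/v -/U.
case/lastP: v => [|v p] uE hU szv hS hix; first by move: hix;
  rewrite /high /insert_pos /=; lia.
have {szv} [szv lop] : size (row1 v) <= k /\ insert_pos p (row1 v) < k.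
  by move: szv; rewrite row1_rcons size_row_insert; lia.
move: uE; rewrite !merge_runs_rcons; case: eqP => [rp|nrp] uE; last first.
  (* If [p] has rank below [k], it cannot separate [x] from its run. *)
  have hS' : all (high k v) (sort leq U).
    by apply: sub_all hS => z; apply: high_rcons_low; lia.
  have [_ s1 _] := merge_runs_spec k0 szv hS' sS.
  move: (merge_runs k v _) uE s1 => u0 uE s1; move: W;
    rewrite uE -[rcons u0 p]cats1 => W.
  have nhp : ~~ high k u0 p by rewrite high_low_high s1 /high; lia.
  case/negP: (rising_runs_next_low k0 W nhp).
  by rewrite high_low_high s1; apply: high_rcons_low hix; lia.
have [|_ s1 _] := merge_runs_spec k0 szv (filter_all (high k v) (sort leq U)).
  exact: sorted_filter leq_trans _ _ sS.
move e0: (merge_runs k v _) uE s1 => u0 uE s1.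
have nhp : ~~ high k u0 p by rewrite high_low_high s1 /high; lia.
(* The run of [x] starts at [p], and its letters are at most [x]. *)
have nhx : ~~ high k v x.
  by move: W; rewrite uE => /rising_runs_next_low /(_ nhp); rewrite high_low_high s1;
    apply.
have px : p <= x := high_rcons_ge lop hix.
have rp0 : k <= (insert_pos p (row1 u0)).+1.
  by have := insert_pos_take k p (row1_sorted u0); rewrite -row1_low_high s1; lia.
move: W; rewrite {1}uE => /rising_runs_next_ge /(_ rp0 px) lex.
rewrite uE.
have trl := leq_trans; have totl := leq_total.
have -> : filter (high k v) (sort leq (rcons U x)) = filter (high k v) (sort leq U).
  by rewrite !filter_sort // filter_rcons (negbTE nhx).
have -> : filter (predC (high k v)) (sort leq (rcons U x)) =
          rcons (filter (predC (high k v)) (sort leq U)) x.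
  rewrite !filter_sort // filter_rcons /= nhx.
  apply: (sorted_eq (leT := leq)) => //; first exact: anti_leq.
  - exact: sort_sorted.
  - rewrite (sorted_pairwise trl) pairwise_rcons -(sorted_pairwise trl) sort_sorted // andbT.
    by rewrite all_sort -(all_sort _ leq) -filter_sort.
  by rewrite perm_sort perm_rcons perm_sym perm_rcons perm_cons perm_sort.
by rewrite e0 rcons_cat.
Qed.

(** Moves the letters of rank above [k] to the end, in sorted order. *)
Definition straighten k u := (low_high k u).1 ++ sort leq (low_high k u).2.

Lemma straighten_perm k u : perm_eq (straighten k u) u.
Proof.
by apply: perm_trans (low_high_perm k u); rewrite perm_cat2l perm_sort.
Qed.

Lemma low_high_straighten k u : low_high k (straighten k u) = ((low_high k u).1, sort leq (low_high k u).2).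
Proof.
rewrite /straighten (low_high_cat (low_high_small (size_row1_low_high k u))) //.
by rewrite all_sort low_high_all_high.
Qed.

Lemma straighten_rising_tail k u : rising_tail k (straighten k u).
Proof.
by apply: rising_tail_cat (size_row1_low_high k u) _; exact: sort_sorted leq_total _.
Qed.

Lemma straighten_inj k u v : 0 < k -> rising_runs k u -> rising_runs k v ->
  straighten k u = straighten k v -> u = v.
Proof.
move=> k0 Wu Wv e; have := low_high_straighten k u; rewrite e low_high_straighten.
by case=> e1 e2; rewrite (rising_runs_merge k0 Wu) (rising_runs_merge k0 Wv) e1 e2.
Qed.

Lemma straighten_surj k w : 0 < k -> rising_tail k w -> exists2 u, rising_runs k u & straighten k u = w.
Proof.
move=> k0 /rising_tail_low_high [wE sU].
have [W s1 s2] := merge_runs_spec k0 (size_row1_low_high k w) (low_high_all_high k w) sU.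
exists (merge_runs k (low_high k w).1 (low_high k w).2); first by [].
rewrite /straighten s1 [RHS]wE; congr (_ ++ _).
apply: (sorted_eq leq_trans anti_leq) => //; first exact: sort_sorted leq_total _.
by rewrite perm_sort.
Qed.

(** * Standardization *)

(** The stable order on the positions of the word [w]: by letters, then by
    positions. *)
Definition key_lt (w : nat -> nat) (i j : nat) := (w i < w j) || (w i == w j) && (i < j).

Lemma key_lt_irr w i : key_lt w i i = false.
Proof. by rewrite /key_lt; lia. Qed.

Lemma key_lt_trans w : transitive (key_lt w).
Proof. by move=> j i l; rewrite /key_lt; lia. Qed.

Lemma key_lt_total w i j : i != j -> key_lt w i j || key_lt w j i.
Proof. by rewrite /key_lt; lia. Qed.

Lemma key_lt_le w i j : i < j -> key_lt w i j = (w i <= w j).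
Proof. by rewrite /key_lt; lia. Qed.

Definition key_rank n w (i : 'I_n) : nat := #|[set j : 'I_n | key_lt w j i]|.

Lemma key_rankP n w (i j : 'I_n) : key_lt w i j = (key_rank w i < key_rank w j).
Proof.
have mono (a b : 'I_n) : key_lt w a b -> key_rank w a < key_rank w b.
  move=> ab; apply/proper_card/properP; split.
    by apply/fintype.subsetP => c; rewrite !inE => ca; exact: key_lt_trans ca ab.
  by exists a; rewrite !inE ?key_lt_irr.
apply/idP/idP; first exact: mono.
have [->|ne] := eqVneq i j; first by rewrite ltnn.
have := key_lt_total w (ne : val i != val j).
case/orP => // /mono; lia.
Qed.

Lemma key_rank_lt n w (i : 'I_n) : key_rank w i < n.
Proof.
rewrite -[X in _ < X]card_ord /key_rank -cardsT; apply: proper_card.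
by apply/properP; split; [exact: finset.subsetT|exists i; rewrite !inE ?key_lt_irr].
Qed.

Definition key_ord n w (i : 'I_n) : 'I_n := Ordinal (key_rank_lt w i).

Lemma key_ord_inj n w : injective (@key_ord n w).
Proof.
move=> i j /(congr1 val) /= e; apply/eqP; apply/negPn/negP => ne.
have := key_lt_total w (ne : val i != val j); rewrite !key_rankP e; lia.
Qed.

(** The permutation that lists the positions of [w] in the order [key_lt]; it
    is the inverse of the usual standardization. *)
Definition std n w : 'S_n := ((perm (@key_ord_inj n w))^-1)%g.

Lemma std_key_lt n w (a b : 'I_n) : key_lt w (std n w a) (std n w b) = (a < b).
Proof.
have e (c : 'I_n) : key_rank w (std n w c) = c.
  by rewrite -[RHS](congr1 val (permKV (perm (@key_ord_inj n w)) c)) permE.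
by rewrite key_rankP !e.
Qed.

Lemma card_ord_lt n a : a <= n -> #|[set b : 'I_n | b < a]| = a.
Proof.
move=> le; rewrite cardsE -sum1_card (big_ord_narrow le).
by rewrite sum_nat_const card_ord muln1.
Qed.

Lemma std_uniq n w (s : 'S_n) :
  (forall a b : 'I_n, a < b -> key_lt w (s a) (s b)) -> s = std n w.
Proof.
move=> H; have H' (a b : 'I_n) : key_lt w (s a) (s b) = (a < b).
  case: (ltngtP a b) => [/H //|/H lt|/val_inj ->]; last by rewrite key_lt_irr.
  by apply/negP => lt2; have := key_lt_trans lt lt2; rewrite key_lt_irr.
suff e a : key_rank w (s a) = a.
  apply/permP => a; apply: (@perm_inj _ (perm (@key_ord_inj n w))).
  by rewrite permKV permE; apply: val_inj; exact: e.
rewrite /key_rank -[RHS](card_ord_lt (ltnW (ltn_ord a))).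
rewrite -[RHS](card_imset _ (@perm_inj _ s)).
congr #|pred_of_set _|; apply/setP => j; rewrite inE; apply/idP/imsetP => [lt|[b]].
  by exists ((s^-1)%g j); rewrite ?inE -?H' permKV.
by rewrite inE -H' => lt ->.
Qed.

Lemma mono_perm1 n (s : 'S_n) : (forall a b : 'I_n, a < b -> s a < s b) -> s = 1%g.
Proof.
move=> H; rewrite (@std_uniq n (fun=> 0) s) => [|a b /H lt]; last by rewrite key_lt_le.
by apply/esym/std_uniq => a b lt; rewrite !perm1 key_lt_le.
Qed.

(** The values of [std n w] are positions of [w], and its positions are indices
    in the order [key_lt]; so the roles of positions and values of [p] are
    exchanged. *)
Lemma contains_std n w m (p : 'S_m) : contains (std n w) p <->
  exists h : 'I_m -> 'I_n, (forall a b : 'I_m, a < b -> h a < h b) /\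
    (forall a b : 'I_m, a < b -> key_lt w (h (p a)) (h (p b))).
Proof.
split=> [/existsP [f /forallP H]|[h [H1 H2]]].
  have {}H a b := andP (forallP (H a) b).
  exists (fun c => std n w (f ((p^-1)%g c))); split=> a b lt.
    by have [_ /eqP <-] := H ((p^-1)%g a) ((p^-1)%g b); rewrite !permKV.
  by rewrite !permK std_key_lt; have [/implyP/(_ lt)] := H a b.
have H1' a b : (h a < h b) = (a < b).
  case: (ltngtP a b) => [/H1 //|/H1 lt|/val_inj ->]; last by rewrite ltnn.
  by apply/negbTE; rewrite -leqNgt ltnW.
apply/existsP; exists [ffun c => ((std n w)^-1)%g (h (p c))].
apply/forallP => a; apply/forallP => b; rewrite !ffunE !permKV H1' eqxx andbT.
by apply/implyP => /H2; rewrite -(std_key_lt w) !permKV.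
Qed.

Lemma subseq_embedding m u s : size s = m -> subseq s u <->
  exists h : 'I_m -> 'I_(size u), (forall a b : 'I_m, a < b -> h a < h b) /\
    (forall a : 'I_m, nth 0 s a = nth 0 u (h a)).
Proof.
move=> szs; split=> [/subseqP [b szb sE]|[h [H1 H2]]].
  pose idx := mask b (iota 0 (size u)).
  have sE' : s = map (nth 0 u) idx by rewrite /idx map_mask map_nth_iota0 // take_size.
  have szi : size idx = m by rewrite -szs sE' size_map.
  have lti (a : 'I_m) : nth 0 idx a < size u.
    have : nth 0 idx a \in idx by rewrite mem_nth // szi.
    by move/mem_mask; rewrite mem_iota.
  exists (fun a => Ordinal (lti a)); split=> [a c lt|a] /=; last first.
    by rewrite sE' (nth_map 0) // szi.
  have si : sorted ltn idx by apply: sorted_mask;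
    [exact: ltn_trans|exact: iota_ltn_sorted].
  by apply: (sorted_ltn_nth ltn_trans 0 si); rewrite ?inE ?szi.
pose idx := [seq val (h a) | a <- enum 'I_m].
have szi : size idx = m by rewrite size_map size_enum_ord.
have nthi (a : 'I_m) : nth 0 idx a = h a by rewrite (nth_map a) ?size_enum_ord // nth_ord_enum.
have sE : s = map (nth 0 u) idx.
  apply: (@eq_from_nth _ 0); first by rewrite size_map szi.
  move=> i; rewrite szs => lti; rewrite (nth_map 0) ?szi //.
  by have := H2 (Ordinal lti); rewrite /= => ->; rewrite (nthi (Ordinal lti)).
have si : sorted ltn idx.
  rewrite sorted_map; apply: (@sub_sorted _ (relpre val ltn)) => [a c /= /H1 //|].
  by rewrite -sorted_map val_enum_ord iota_ltn_sorted.
have : subseq idx (iota 0 (size u)).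
  suff -> : idx = filter (mem idx) (iota 0 (size u)) by exact: filter_subseq.
  apply: (irr_sorted_eq ltn_trans ltnn si).
    exact: sorted_filter ltn_trans _ _ (iota_ltn_sorted _ _).
  move=> i; rewrite mem_filter mem_iota /= add0n.
  apply/idP/andP => [ii|[ii _]]; last exact: ii.
  by split; [exact: ii|case/mapP: ii => a _ ->; exact: ltn_ord].
by move/(map_subseq (nth 0 u)); rewrite -sE map_nth_iota0 // take_size.
Qed.

(** * Patterns with one displaced letter *)

(** Equivalent to the occurrence in [std u] of some pattern obtained by moving
    the value [v] in an identity permutation. *)
Definition contains_inserted v m (u : seq nat) := exists s,
  [/\ subseq s u, size s = m, sorted leq (take v s ++ drop v.+1 s) & ~~ sorted leq s].

Lemma nth_delete v (s : seq nat) i : nth 0 (take v s ++ drop v.+1 s) i = nth 0 s (bump v i).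
Proof.
rewrite nth_cat size_take_min /bump; case: (ltnP i (minn v (size s))) => lti.
  by rewrite nth_take; [have -> : (v <= i) = false by lia|lia].
rewrite nth_drop; case: (leqP v i) => levi.
  case: (leqP v (size s)) => les; first by congr nth; lia.
  by rewrite !nth_default //; lia.
by rewrite !nth_default //; lia.
Qed.

Lemma size_delete v (s : seq nat) : v < size s -> size (take v s ++ drop v.+1 s) = (size s).-1.
Proof. by move=> lt; rewrite size_cat size_take_min size_drop; lia. Qed.

Lemma down_closed_ord m (P : 'I_m -> bool) :
  (forall a b : 'I_m, a < b -> P b -> P a) ->
  exists2 j, j <= m & forall i : 'I_m, P i = (i < j).
Proof.
move=> down; pose Q c := [exists i : 'I_m, (c <= i) && P i].
exists (count Q (iota 0 m)); first by rewrite -[X in _ <= X](size_iota 0) count_size.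
move=> i; rewrite -(@nth_sorted_count Q (iota 0 m)) ?size_iota ?iota_sorted //.
  rewrite nth_iota // add0n; apply/idP/existsP => [Pi|[i' /andP[]]];
    first by exists i; rewrite leqnn.
  by rewrite leq_eqVlt => /orP[/eqP/val_inj -> //|]; exact: down.
by move=> a b leab /existsP [c /andP[lebc Pc]]; apply/existsP; exists c;
  rewrite (leq_trans leab).
Qed.

(** The permutation [lift_perm j v 1] takes the value [v] at [j] and is
    increasing elsewhere.  So an occurrence in [std u] amounts to positions
    [h 0 < ... < h m] of [u] which, apart from [h v], are increasing for [key_lt],
    [h v] coming in place [j].  As [j] varies, the last condition only says that
    the order including [h v] is not the natural one. *)
Lemma contains_inserted_lift_perm m (v : 'I_m.+1) (u : seq nat) :
  (exists2 j, j != v & contains (std (size u) (nth 0 u)) (lift_perm j v 1)) <->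
  contains_inserted v m.+1 u.
Proof.
set w := nth 0 u; split=> [[j nj /contains_std [h [H1 H2]]]|].
  exists [seq w (h a) | a <- enum 'I_m.+1].
  have szs : size [seq w (h a) | a <- enum 'I_m.+1] = m.+1 by rewrite size_map size_enum_ord.
  have nths (a : 'I_m.+1) : nth 0 [seq w (h a) | a <- enum 'I_m.+1] a = w (h a).
    by rewrite (nth_map a) ?size_enum_ord // nth_ord_enum.
  split=> //; first by apply/(subseq_embedding u szs); exists h.
    apply/sorted_nthP => a b leab; rewrite size_delete szs //= !nth_delete => ltb.
    have lta : a < m by lia.
    have -> : bump v a = lift v (Ordinal lta) by [].
    have -> : bump v b = lift v (Ordinal ltb) by [].
    rewrite !nths; move: leab; rewrite leq_eqVlt => /orP[/eqP e|lt].
      have -> : Ordinal lta = Ordinal ltb by apply: val_inj.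
      by [].
    have := H2 (lift j (Ordinal lta)) (lift j (Ordinal ltb)).
    rewrite !lift_perm_lift !perm1 key_lt_le; first by apply; rewrite /= /bump; lia.
    by apply: H1; rewrite /= /bump; lia.
  apply: contraNN nj => /sorted_nthP srt.
  suff e : lift_perm j v 1 = 1%g by rewrite -(lift_perm_id j v 1) e perm1.
  apply: mono_perm1 => a b /H2 lt; rewrite ltnNge; apply/negP; rewrite leq_eqVlt.
  case/orP=> [/eqP/val_inj e|lt2]; first by rewrite e key_lt_irr in lt.
  have : key_lt w (h (lift_perm j v 1 b)) (h (lift_perm j v 1 a)).
    by rewrite key_lt_le ?H1 // -!nths srt ?szs // ltnW.
  by move/(key_lt_trans lt); rewrite key_lt_irr.
move=> [s [sub szs srt nsrt]]; have [h [H1 H2]] := (subseq_embedding u szs).1 sub.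
have H1' a b : (h a < h b) = (a < b).
  case: (ltngtP a b) => [/H1 //|/H1 lt|/val_inj ->]; last by rewrite ltnn.
  by apply/negbTE; rewrite -leqNgt ltnW.
have hinj : injective h.
  by move=> a b e; apply/val_inj; case: (ltngtP a b) => // /H1; rewrite e ltnn.
have chain (a b : 'I_m) : a < b -> key_lt w (h (lift v a)) (h (lift v b)).
  move=> lt; rewrite key_lt_le; last by apply: H1; rewrite /= /bump; lia.
  have := (sorted_nthP _).1 srt a b (ltnW lt); rewrite size_delete szs //= !nth_delete.
  by rewrite [nth 0 s (bump v a)](H2 (lift v a)) [nth 0 s (bump v b)](H2 (lift v b));
    apply.
(* [j0] is the number of the other positions that precede [h v] for [key_lt]. *)
have [a b lt /= ltb|j0 lej jP] := @down_closed_ord m (fun i =>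
  key_lt w (h (lift v i)) (h v)).
  exact: key_lt_trans (chain a b lt) ltb.
have ltj : j0 < m.+1 by lia.
pose j := Ordinal ltj.
have H3 (a b : 'I_m.+1) : a < b -> key_lt w (h (lift_perm j v 1 a)) (h (lift_perm j v 1 b)).
  case: (unliftP j a) => [a'|] ->; case: (unliftP j b) => [b'|] ->;
    rewrite ?lift_perm_id ?lift_perm_lift ?perm1.
  - by move=> lt; apply: chain; move: lt; rewrite /= /bump; lia.
  - by rewrite jP /= /bump; lia.
  - move=> lt; have : h v != h (lift v b') :> nat.
      by apply/eqP => /val_inj/hinj e; have := neq_lift v b'; rewrite -e eqxx.
    move/(key_lt_total w); rewrite [X in _ || X]jP; move: lt; rewrite /= /bump; lia.
  - by rewrite ltnn.
exists j; last by apply/contains_std; exists h.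
apply: contraNN nsrt => /eqP e; apply/sorted_nthP => a b; rewrite szs => leab ltb.
have lta : a < m.+1 by lia.
have := H2 (Ordinal lta); have := H2 (Ordinal ltb) => /= -> ->.
move: leab; rewrite leq_eqVlt => /orP[/eqP eab|lt].
  by have -> : Ordinal lta = Ordinal ltb by apply: val_inj.
have := H3 (Ordinal lta) (Ordinal ltb) lt; rewrite e lift_perm1 !perm1.
by rewrite key_lt_le // H1.
Qed.

(** * Avoidance of partial shuffles as a condition on words *)

Lemma subseq_rcons_nth (u s : seq nat) y :
  subseq (rcons s y) u <-> exists p, [/\ p < size u, nth 0 u p = y & subseq s (take p u)].
Proof.
split=> [|[p [ltp <- sub]]]; last first.
  rewrite -[X in subseq _ X](cat_take_drop p) (drop_nth 0 ltp) -cats1.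
  by apply: cat_subseq => //=; rewrite eqxx sub0seq.
elim/last_ind: u => [|u z IHu]; first by case: s.
have [ez sub|nz sub] := eqVneq y z.
  exists (size u);
    rewrite size_rcons leqnn nth_rcons ltnn eqxx ez -cats1 take_size_cat //.
  by split=> //; move: sub; rewrite -subseq_rev !rev_rcons /= ez eqxx subseq_rev.
have [|p [ltp np sp]] := IHu.
  move: sub; rewrite -subseq_rev !rev_rcons /= (negbTE nz) -(subseq_rev (rcons s y)).
  by rewrite rev_rcons.
exists p; rewrite size_rcons ltnW // nth_rcons ltp; split=> //.
by rewrite -cats1 takel_cat // ltnW.
Qed.

(** The last two letters of the subsequence are a letter of rank above [k]
    and a smaller one after it. *)
Lemma contains_last_rising_tail k u : contains_inserted k.+1 k.+2 u <-> ~ rising_tail k u.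
Proof.
split=> [[s [sub szs srt nsrt]] W|nW].
  case/lastP: s => [//|s z] in sub szs srt nsrt.
  case/lastP: s => [//|s y] in sub szs srt nsrt.
  move: szs; rewrite !size_rcons => -[szs].
  have /subseq_rcons_nth [q [ltq uq sub1]] := sub.
  have /subseq_rcons_nth [p [ltp up sub2]] := sub1.
  have ltpq : p < q by move: ltp; rewrite size_take; case: ifP; lia.
  move: up; rewrite nth_take // => up; move: sub2;
    rewrite take_takel ?(ltnW ltpq) // => sub2.
  have srt' : sorted leq (rcons s y).
    by move: srt;
      rewrite -[rcons (rcons s y) z]cats1 take_size_cat ?drop_oversize ?cats0 ?size_cat ?size_rcons ?szs ?addn1.
  have : k < rank u p by rewrite ltnS up; apply/increasing_subseq_row1; exists s.
  move/(W p q ltpq ltq); rewrite up uq => leyz.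
  by move: nsrt; rewrite sorted_rcons2 srt' leyz.
apply: contrapT => nc; apply: nW => p q ltpq ltq kr; rewrite leqNgt; apply/negP => ltu.
have [s [sub szs srt]] := (increasing_subseq_row1 _ _ _).2 (kr : k <= _).
apply: nc; exists (rcons (rcons s (nth 0 u p)) (nth 0 u q)); split.
- apply/subseq_rcons_nth; exists q; split=> //; apply/subseq_rcons_nth; exists p.
  by rewrite nth_take // size_take ltq take_takel ?(ltnW ltpq).
- by rewrite !size_rcons szs.
- by rewrite -[rcons (rcons s _) _]cats1 take_size_cat ?drop_oversize ?cats0 ?size_cat ?size_rcons ?szs ?addn1.
- by rewrite sorted_rcons2 leqNgt ltu andbF.
Qed.

(** The last three letters of the subsequence are the letters at positions
    [p], [q] and [r] of [rising_runs]. *)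
Lemma contains_penultimate_rising_runs k u : 0 < k -> contains_inserted k k.+2 u <-> ~ rising_runs k u.
Proof.
case: k => [//|k] _; split=> [[s [sub szs srt nsrt]] W|nW].
  case/lastP: s => [//|s z] in sub szs srt nsrt.
  case/lastP: s => [//|s y] in sub szs srt nsrt.
  case/lastP: s => [//|s x] in sub szs srt nsrt.
  move: szs; rewrite !size_rcons => -[szs].
  have /subseq_rcons_nth [r [ltr ur sub1]] := sub.
  have /subseq_rcons_nth [q [ltq uq]] := sub1.
  have ltqr : q < r by move: ltq; rewrite size_take; case: ifP; lia.
  rewrite take_takel ?(ltnW ltqr) // => /subseq_rcons_nth [p [ltp up]].
  have ltpq : p < q by move: ltp; rewrite size_take; case: ifP; lia.
  rewrite take_takel ?(ltnW ltpq) // => sub3.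
  move: uq up; rewrite !nth_take // => uq up.
  have srt' : sorted leq (rcons (rcons s x) z).
    move: srt; rewrite -[rcons (rcons (rcons s x) y) z]cats1 -[rcons (rcons s x) y]cats1 -catA.
    by rewrite take_size_cat ?size_rcons ?szs // drop_cat size_rcons szs ltnNge leqnSn /= subSnn /= ?drop0 cats1.
  move: srt'; rewrite sorted_rcons2 => /andP[srt' lexz].
  have : k < rank u p by rewrite ltnS up; apply/increasing_subseq_row1; exists s.
  move/(W p q r ltpq ltqr ltr); rewrite up uq ur => /(_ lexz) le.
  by move: nsrt; rewrite 2!sorted_rcons2 srt' le.
apply: contrapT => nc; apply: nW => p q r ltpq ltqr ltr kr lepr;
  apply/negPn/negP => nle.
have [s [sub szs srt]] := (increasing_subseq_row1 _ _ _).2 (kr : k <= _).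
apply: nc; exists (rcons (rcons (rcons s (nth 0 u p)) (nth 0 u q)) (nth 0 u r)); split.
- apply/subseq_rcons_nth; exists r; split=> //; apply/subseq_rcons_nth; exists q.
  rewrite nth_take // size_take ltr take_takel ?(ltnW ltqr) //; split=> //.
  have ltq : q < size u by lia.
  by apply/subseq_rcons_nth; exists p;
    rewrite nth_take // size_take ltq take_takel ?(ltnW ltpq).
- by rewrite !size_rcons szs.
- rewrite -[rcons (rcons (rcons s _) _) _]cats1 -[rcons (rcons s _) _]cats1 -catA.
  rewrite take_size_cat ?size_rcons ?szs // drop_cat size_rcons szs ltnNge leqnSn /= subSnn /= ?drop0 cats1.
  by rewrite sorted_rcons2 srt.
- by rewrite 2!sorted_rcons2 srt /=.
Qed.

Lemma nth_insert j x (w : seq nat) i : j <= size w ->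
  nth 0 (insert j x w) (bump j i) = nth 0 w i.
Proof.
move=> lej; rewrite /insert nth_cat size_takel // /bump; case: (leqP j i) => leji.
  rewrite ltnNge ltnW //= ?add1n // subSn //= nth_drop; congr nth; lia.
by rewrite add0n leji nth_take.
Qed.

Lemma nth_insert_same j x (w : seq nat) : j <= size w -> nth 0 (insert j x w) j = x.
Proof. by move=> lej; rewrite /insert nth_cat size_takel // ltnn subnn. Qed.

Lemma nth_one_line n (s : 'S_n) (i : 'I_n) : nth 0 (one_line s) i = (s i).+1.
Proof. by rewrite (nth_map i) ?size_enum_ord // nth_ord_enum. Qed.

Lemma size_one_line n (s : 'S_n) : size (one_line s) = n.
Proof. by rewrite size_map size_enum_ord. Qed.

Lemma one_line_lift_perm m (j v : 'I_m.+1) :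
  one_line (lift_perm j v 1) = insert j v.+1 [seq (bump v i).+1 | i <- iota 0 m].
Proof.
have szb : size [seq (bump v i).+1 | i <- iota 0 m] = m by rewrite size_map size_iota.
have lej : j <= size [seq (bump v i).+1 | i <- iota 0 m] by rewrite szb -ltnS.
apply: (@eq_from_nth _ 0).
  by rewrite size_one_line size_cat /= size_takel // size_drop szb; lia.
rewrite size_one_line => a lta; rewrite (nth_one_line _ (Ordinal lta)).
have [i e|e] := unliftP j (Ordinal lta).
  rewrite e lift_perm_lift perm1;
    have -> : a = bump j i by rewrite -[a]/(val (Ordinal lta)) e.
  by rewrite nth_insert // (nth_map 0) ?size_iota // nth_iota.
rewrite e lift_perm_id; have -> : a = j by rewrite -[a]/(val (Ordinal lta)) e.
by rewrite nth_insert_same.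
Qed.

Lemma one_line_inj n : injective (@one_line n).
Proof.
move=> s t e; apply/permP => i; apply: val_inj; apply: succn_inj.
by rewrite -!nth_one_line e.
Qed.

Lemma lift_perm_eq1 m (j v : 'I_m.+1) : (lift_perm j v 1 == 1%g) = (j == v).
Proof.
apply/eqP/eqP => [e|->]; last exact: lift_perm1.
by rewrite -(lift_perm_id j v 1) e perm1.
Qed.

(** Covers [Pi_k2], with [v] the maximum, and [Pi_k1], with [v] the value
    before the maximum. *)
Lemma avoiders_inserted m (v : 'I_m.+1) (P : {set 'S_m.+1}) u :
  (forall p, p \in P <-> p != 1%g /\
     exists j : 'I_m.+1, one_line p = insert j v.+1 [seq (bump v i).+1 | i <- iota 0 m]) ->
  std (size u) (nth 0 u) \in avoiders (size u) P <-> ~ contains_inserted v m.+1 u.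
Proof.
move=> HP; rewrite -contains_inserted_lift_perm inE; split=> [/forallP av [j nj c]|nc].
  have := av (lift_perm j v 1); rewrite c implybF => /negP; apply; apply/HP.
  by rewrite lift_perm_eq1; split=> //; exists j; rewrite one_line_lift_perm.
apply/forallP => p; apply/implyP => /HP [p1 [j pE]]; apply/negP => c.
have pE' : p = lift_perm j v 1 by apply: one_line_inj; rewrite one_line_lift_perm.
by apply: nc; exists j; [rewrite -lift_perm_eq1 -pE'|rewrite -pE'].
Qed.

Lemma avoiders_Pi_k2 k u :
  std (size u) (nth 0 u) \in avoiders (size u) (Pi_k2 k) <-> rising_tail k u.
Proof.
rewrite (@avoiders_inserted k.+1 ord_max) => [|p];
  first by rewrite contains_last_rising_tail; split=> [/contrapT|w /(_ w)].
have -> : [seq (bump (@ord_max k.+1) i).+1 | i <- iota 0 k.+1] = iota 1 k.+1.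
  apply: (@eq_from_nth _ 0); rewrite size_map !size_iota // => i lti.
  by rewrite (nth_map 0) ?size_iota // !nth_iota // /bump /=; lia.
rewrite inE; split=> [/andP[-> /existsP[j /eqP e]]|[-> [j e]]]; first by split=> //;
  exists j.
by apply/existsP; exists j; apply/eqP.
Qed.

Lemma avoiders_Pi_k1 k u : 0 < k ->
  std (size u) (nth 0 u) \in avoiders (size u) (Pi_k1 k) <-> rising_runs k u.
Proof.
move=> k0; have ltk : k < k.+2 by lia.
rewrite (@avoiders_inserted k.+1 (Ordinal ltk)) => [|p].
  by rewrite contains_penultimate_rising_runs //; split=> [/contrapT|w /(_ w)].
have -> : [seq (bump (Ordinal ltk) i).+1 | i <- iota 0 k.+1] = rcons (iota 1 k) k.+2.
  apply: (@eq_from_nth _ 0); rewrite size_map ?size_rcons !size_iota // => i lti.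
  rewrite (nth_map 0) ?size_iota // nth_rcons size_iota nth_iota // /bump /=.
  by case: ltnP => ltik; [rewrite nth_iota //; lia|case: eqP; lia].
rewrite inE; split=> [/andP[-> /existsP[j /eqP e]]|[-> [j e]]]; first by split=> //;
  exists j.
by apply/existsP; exists j; apply/eqP.
Qed.

(** * Coefficients as numbers of words *)

(** The number of elements of a finite set, as a sum of ones, for which
    bijections and partitions are reindexing and exchange of sums. *)
Definition nelem (I : choiceType) (A : set I) : int := (\sum_(a \in A) (1 : int))%R.

Lemma nelem_bij (I J : choiceType) (A : set I) (B : set J) (f : I -> J) :
  (forall a, A a -> B (f a)) ->
  (forall a a', A a -> A a' -> f a = f a' -> a = a') ->
  (forall b, B b -> exists2 a, A a & f a = b) -> nelem A = nelem B.
Proof.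
move=> H1 H2 H3; rewrite /nelem (@reindex_fsbig _ _ _ _ _ f A B) //; split.
- by move=> a /= /H1.
- by move=> a a' /set_mem Aa /set_mem Aa'; exact: H2.
- by move=> b /H3 [a Aa <-]; exists a.
Qed.

Lemma monomial_sum_nelem (I : choiceType) (A : set I) w m :
  monomial_sum A w m = nelem (A `&` [set a | w a = m])%classic.
Proof.
rewrite /monomial_sum /nelem fsbig_mkcondr; apply: eq_fsbigr => a _.
by case: ifPn; rewrite ?inE ?notin_setE /= => /eqP; [move=> ->|move/negbTE => ->].
Qed.

Lemma nelem_partition (I J : choiceType) (A : set I) (B : set J) (f : I -> J) :
  finite_set A -> finite_set B -> (forall a, A a -> B (f a)) ->
  nelem A = (\sum_(b \in B) nelem (A `&` [set a | f a = b])%classic)%R.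
Proof.
move=> fA fB AB; rewrite /nelem.
transitivity ((\sum_(a \in A) \sum_(b \in B) ((f a == b)%:R : int))%R); last first.
  rewrite exchange_fsbig //; apply: eq_fsbigr => b _.
  rewrite fsbig_mkcondr; apply: eq_fsbigr => a _.
  by case: ifPn; rewrite ?inE ?notin_setE /= => /eqP; [move=> ->|move/negbTE => ->].
apply: eq_fsbigr => a; rewrite inE => Aa.
rewrite -(fsbig_widen [set f a] B) => [|_ -> //=|b [_ /= nb]]; [|exact: AB|].
  by rewrite fsbig_set1 eqxx.
by case: eqP => // e; case: nb.
Qed.

Lemma nelem_finset (T : finType) (A : {set T}) : nelem [set` A] = (#|A|%:R)%R.
Proof.
rewrite /nelem -(@bigfs _ _ _ _ (index_enum T)) ?index_enum_uniq //.
  by rewrite sumr_const.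
by move=> i _; rewrite mem_index_enum.
Qed.

Definition monomial (u : seq nat) : {cmonom nat} := \big[mmul/mone]_(x <- u) ucm x.

Lemma monomial_perm u v : perm_eq u v -> monomial u = monomial v.
Proof. exact: perm_big. Qed.

Lemma monomial_count u x : monomial u x = count_mem x u.
Proof.
rewrite /monomial; elim: u => [|y u IHu]; first by rewrite big_nil cm1.
by rewrite big_cons cmM IHu ucmE.
Qed.

Lemma monomial_eq u v : monomial u = monomial v -> perm_eq u v.
Proof.
move=> e; apply/allP => x _ /=; apply/eqP.
by rewrite -!monomial_count e.
Qed.

(** Two words with the same monomial are permutations of each other. *)
Lemma finite_monomial m : finite_set [set u | monomial u = m].
Proof.
have [[u0 <-]|nu] := pselect (exists u, monomial u = m).
  apply: (@sub_finite_set _ _ [set` permutations u0]); last exact: finite_seq.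
  by move=> u /= /monomial_eq; rewrite mem_permutations.
by apply: (@sub_finite_set _ _ set0) => // u /= e; case: nu; exists u.
Qed.

Section DescentClass.
Variables (n : nat) (s : 'S_n).

Let S i := nth 0 (one_line s) i.

Let descent_tuple := [set t : n.-tuple nat | forall i : 'I_n.-1,
  (nth 0 t i <= nth 0 t i.+1) /\ (i \in Des s -> nth 0 t i < nth 0 t i.+1)]%classic.

Lemma chain_lt (R : rel nat) : transitive R -> 
  (forall i, i.+1 < n -> R i i.+1) -> forall i j, i < j -> j < n -> R i j.
Proof.
move=> tR H i; elim=> [//|j IHj]; rewrite ltnS leq_eqVlt => /orP[/eqP ->|ltij] ltj;
  first exact: H.
by apply: tR (IHj ltij (ltnW ltj)) (H _ ltj).
Qed.

(** The tuple [t] lists the letters of [w] in the order [s].  It is weakly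
    increasing, and strictly at the descents of [s], exactly when consecutive
    positions in this order increase for [key_lt]. *)
Lemma descent_tupleP (t : n.-tuple nat) w : 
  (forall a : 'I_n, nth 0 w (s a) = nth 0 t a) ->
  descent_tuple t <-> std n (nth 0 w) = s.
Proof.
move=> wE; pose R i j := (nth 0 t i < nth 0 t j) || (nth 0 t i == nth 0 t j) && (S i < S j).
have RE (a b : 'I_n) : key_lt (nth 0 w) (s a) (s b) = R a b.
  by rewrite /key_lt /R /S !wE !nth_one_line.
have neS i : i.+1 < n -> S i != S i.+1.
  move=> lt; have lti : i < n by lia.
  rewrite /S (nth_one_line s (Ordinal lti)) (nth_one_line s (Ordinal lt)).
  by rewrite eqSS; apply/eqP => /val_inj /perm_inj /(congr1 val) /=; lia.
have step : descent_tuple t <-> (forall i, i.+1 < n -> R i i.+1).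
  split=> [H i lt|H i].
    have lt1 : i < n.-1 by lia.
    have [le] := H (Ordinal lt1); rewrite inE /= -/(S i) -/(S i.+1) /R.
    move: (neS i lt) le; case: (ltngtP (S i) (S i.+1)) => //= _ _ le;
      last by move=> /(_ isT) ->.
    by move=> _; lia.
  have lt : i.+1 < n by have := ltn_ord i; lia.
  have := H i lt; rewrite inE -/(S i) -/(S i.+1) /R => r; split=> [|ltS]; lia.
rewrite step; split=> [H|e i lt].
  apply/esym/std_uniq => a b lt; rewrite RE; apply: chain_lt lt (ltn_ord b) => //.
  by move=> x y z; rewrite /R; lia.
have lti : i < n by lia.
by have := RE (Ordinal lti) (Ordinal lt); rewrite -e std_key_lt /= => <-.
Qed.

Lemma fundamental_coef m : fundamental (Des s) m =
  nelem [set u | [/\ size u = n, monomial u = m & std n (nth 0 u) = s]]%classic.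
Proof.
rewrite /fundamental monomial_sum_nelem.
have [f fE fperm] : exists2 f : n.-tuple nat -> n.-tuple nat,
    (forall t (a : 'I_n), nth 0 (f t) (s a) = nth 0 t a) & (forall t, perm_eq (f t) t).
  exists (fun t => [tuple tnth t ((s^-1)%g i) | i < n]) => [t a|t].
    by rewrite -!tnth_nth tnth_mktuple permK.
  by apply/tuple_permP; exists (s^-1)%g.
apply: (@nelem_bij _ _ _ _ (fun t => tval (f t))).
- move=> t [/= dt <-]; split; first by rewrite size_tuple.
    exact: monomial_perm (fperm t).
  by apply/(descent_tupleP (fE t)).
- move=> t t' _ _ e; apply: eq_from_tnth => i.
  by rewrite !(tnth_nth 0) -(fE t) -(fE t') e.
move=> u [szu mu su]; have szu' : size u == n by apply/eqP.
pose t : n.-tuple nat := [tuple nth 0 u (s i) | i < n].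
have ft : tval (f t) = u.
  apply: (@eq_from_nth _ 0); rewrite size_tuple // => i lti.
  have := fE t ((s^-1)%g (Ordinal lti)).
  by rewrite permKV -(tnth_nth 0 t) tnth_mktuple permKV.
exists t => //; split.
  apply/(descent_tupleP (w := u)) => // a.
  by rewrite -tnth_nth tnth_mktuple.
by apply: esym; rewrite -mu -ft; exact: monomial_perm (fperm t).
Qed.

End DescentClass.

Lemma Q_coef (n l : nat) (P : {set 'S_l}) m : Q n P m =
  nelem [set u | [/\ size u = n, monomial u = m & std n (nth 0 u) \in avoiders n P]]%classic.
Proof.
rewrite /Q fct_sumE.
rewrite (@bigfs _ _ _ _ (index_enum _)) ?index_enum_uniq //; last first.
  by move=> i _; rewrite mem_index_enum.
rewrite (@nelem_partition _ _ _ [set` avoiders n P] (fun u => std n (nth 0 u))).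
- apply: eq_fsbigr => s; rewrite inE /= => sP; rewrite fundamental_coef; congr nelem.
  apply/seteqP; split=> u /=; first by move=> [? ? e]; rewrite e.
  by move=> [[? ? _] ?].
- by apply: sub_finite_set (finite_monomial m) => u [].
- exact: finite_finset.
- by move=> u [].
Qed.

(** * Semistandard tableaux as lists of rows *)

Lemma mem_diagram la i j : ((i, j) \in diagram la) =
  [&& 0 < i, 0 < j & j <= nth 0 la i.-1].
Proof.
apply/allpairsPdep/and3P => [[i' [j' [+ + [-> ->]]]]|[i0 j0 lej]].
  by rewrite !mem_iota => /andP[i0 _] /andP[j0 lej]; split=> //; lia.
exists i, j; rewrite !mem_iota; split=> //; last by rewrite j0 add1n ltnS.
rewrite i0 /= add1n ltnNge; apply/negP => lt.
by move: lej; rewrite nth_default; lia.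
Qed.

Lemma diagram_uniq la : uniq (diagram la).
Proof.
apply: allpairs_uniq_dep => [|i _|]; [exact: iota_uniq|exact: iota_uniq|].
by move=> [i j] [i' j'] _ _ [-> ->].
Qed.

Lemma box_mem la (b : box la) :
  [&& 0 < row_of b, 0 < col_of b & col_of b <= nth 0 la (row_of b).-1].
Proof. by rewrite -mem_diagram /row_of /col_of -surjective_pairing;
  exact: (valP b). Qed.

Lemma box_ex la r c : c < nth 0 la r -> exists b : box la, row_of b = r.+1 /\
  col_of b = c.+1.
Proof.
move=> lt; have m : (r.+1, c.+1) \in diagram la by rewrite mem_diagram /=.
by exists (SeqSub m).
Qed.

Lemma box_inj la (b b' : box la) : row_of b = row_of b' -> col_of b = col_of b' -> b = b'.
Proof.
by move=> e1 e2; apply: val_inj;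
  rewrite [LHS]surjective_pairing [RHS]surjective_pairing;
  congr pair.
Qed.

Definition entry (T : seq (seq nat)) r c := nth 0 (nth [::] T r) c.

Lemma tableau_entry_col T r c : tableau T -> c < size (nth [::] T r.+1) -> entry T r c < entry T r.+1 c.
Proof.
elim: T r => [|w T IHT] r; first by rewrite nth_nil.
move=> [_ _ [_ dm] tT]; case: r => [|r]; last exact: IHT.
by rewrite /entry /= nth0; apply: dm.
Qed.

Lemma tableau_entry_col_lt T r r' c : tableau T -> r < r' -> c < size (nth [::] T r') ->
  entry T r c < entry T r' c.
Proof.
move=> tT; elim: r' => [//|r' IHr]; rewrite ltnS leq_eqVlt => /orP[/eqP ->|lt] ltc.
  exact: tableau_entry_col.
apply: ltn_trans (tableau_entry_col tT ltc); apply: IHr => //.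
exact: leq_trans ltc (tableau_size r' tT).
Qed.

Lemma tableau_row_sorted T r : tableau T -> sorted leq (nth [::] T r).
Proof.
elim: T r => [|w T IHT] r; first by rewrite nth_nil.
by move=> [_ sw _ tT]; case: r => [|r] //=; exact: IHT.
Qed.

Lemma tableau_intro T :
  (forall r, r < size T -> 0 < size (nth [::] T r)) ->
  (forall r, sorted leq (nth [::] T r)) ->
  (forall r, size (nth [::] T r.+1) <= size (nth [::] T r)) ->
  (forall r c, c < size (nth [::] T r.+1) -> entry T r c < entry T r.+1 c) -> tableau T.
Proof.
elim: T => [//|w T IHT] H1 H2 H3 H4; split.
- exact: (H1 0).
- exact: (H2 0).
- by split=> [|c]; rewrite -nth0; [exact: (H3 0)|exact: (H4 0)].
- by apply: IHT => r;
  [exact: (H1 r.+1)|exact: (H2 r.+1)|exact: (H3 r.+1)|exact: (H4 r.+1)].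
Qed.

(** Turns a list of rows into a filling of the diagram; boxes are numbered from
    1 and lists from 0. *)
Definition filling la (T : seq (seq nat)) : {ffun box la -> nat} :=
  [ffun b => entry T (row_of b).-1 (col_of b).-1].

Lemma nth_shape (T : seq (seq nat)) r : nth 0 (map size T) r = size (nth [::] T r).
Proof.
case: (ltnP r (size T)) => lt; first by rewrite (nth_map [::]).
by rewrite !nth_default ?size_map.
Qed.

Lemma filling_monomial T la : map size T = la ->
  \big[mmul/mone]_(b : box la) ucm (filling la T b) = monomial (flatten T).
Proof.
move=> sh; rewrite -(big_map (filling la T) predT) /=.
apply: monomial_perm; pose g (p : nat * nat) := entry T p.1.-1 p.2.-1.
have -> : [seq filling la T b | b <- index_enum (box la)] = map g (map val (index_enum (box la))).
  by rewrite -map_comp; apply: eq_map => b; rewrite ffunE.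
have -> : flatten T = map g (diagram la).
  rewrite /diagram map_allpairs /= -sh; congr flatten.
  apply: (@eq_from_nth _ [::]); first by rewrite size_map size_iota size_map.
  move=> r ltr;
    rewrite (nth_map 0) ?size_iota ?size_map // nth_iota ?size_map // add1n /=.
  rewrite nth_shape; apply: (@eq_from_nth _ 0); first by rewrite size_map size_iota.
  by move=> c ltc; rewrite (nth_map 0) ?size_iota // nth_iota // add1n.
apply/perm_map/uniq_perm; last 1 first; rewrite ?diagram_uniq //; last first.
  by rewrite (map_inj_uniq val_inj) index_enum_uniq.
move=> p; apply/mapP/idP => [[b _ ->]|pd]; first exact: (valP b).
by exists (SeqSub pd); rewrite ?mem_index_enum.
Qed.

Lemma is_part_shape n la r : is_part n la -> nth 0 la r.+1 <= nth 0 la r.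
Proof.
case/and3P => srt _ _; case: (ltnP r.+1 (size la)) => lt; last by rewrite nth_default.
by move: srt => /(sortedP 0) /(_ r lt).
Qed.

Lemma is_ssytP la (T : {ffun box la -> nat}) : reflect
  (forall b c : box la, (row_of b = row_of c -> col_of b < col_of c -> T b <= T c) /\
                  (col_of b = col_of c -> row_of b < row_of c -> T b < T c)) (is_ssyt T).
Proof.
apply: (iffP forallP) => [H b c|H b].
  have /andP[/implyP H1 /implyP H2] := forallP (H b) c.
  by split=> e lt; [apply: H1|apply: H2]; rewrite e eqxx.
apply/forallP => c; have [H1 H2] := H b c.
by apply/andP; split; apply/implyP => /andP[/eqP e lt]; [exact: H1|exact: H2].
Qed.

Lemma filling_ssyt T la : tableau T -> map size T = la -> is_ssyt (filling la T).
Proof.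
move=> tT sh; apply/is_ssytP => b c; rewrite !ffunE.
have laE r : nth 0 la r = size (nth [::] T r) by rewrite -sh nth_shape.
have := box_mem b; have := box_mem c; rewrite !laE.
move=> /and3P[rc cc lec] /and3P[rb cb leb]; split=> e lt.
  have := (sorted_nthP _).1 (tableau_row_sorted (row_of c).-1 tT) (col_of b).-1 (col_of c).-1.
  by rewrite e /entry; apply; lia.
by rewrite e; apply: tableau_entry_col_lt => //; lia.
Qed.

Lemma filling_inj la T T' : map size T = la -> map size T' = la ->
  filling la T = filling la T' -> T = T'.
Proof.
move=> sh sh' e.
have szT : size T = size T' by rewrite -[LHS](size_map size) sh -sh' size_map.
apply: (@eq_from_nth _ [::] _ _ szT) => r ltr.
have szr : size (nth [::] T r) = size (nth [::] T' r) by rewrite -!nth_shape sh sh'.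
apply: (@eq_from_nth _ 0 _ _ szr) => c ltc.
have [|b [rb cb]] := @box_ex la r c; first by rewrite -sh nth_shape.
by move/ffunP: e => /(_ b); rewrite !ffunE rb cb.
Qed.

Lemma filling_surj n la (F : {ffun box la -> nat}) : is_part n la -> is_ssyt F ->
  exists T, [/\ tableau T, map size T = la & filling la T = F].
Proof.
move=> pla /is_ssytP ssF.
pose g r c := if insub (r.+1, c.+1) : option (box la) is Some b then F b else 0.
have gE (b : box la) : g (row_of b).-1 (col_of b).-1 = F b.
  have /and3P[rb cb _] := box_mem b.
  rewrite /g !prednK // -surjective_pairing.
  by rewrite insubT ?(valP b) // => pb; congr (F _); apply: val_inj.
pose T := [seq [seq g r c | c <- iota 0 (nth 0 la r)] | r <- iota 0 (size la)].
have rowE r : nth [::] T r = [seq g r c | c <- iota 0 (nth 0 la r)].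
  case: (ltnP r (size la)) => lt; first by rewrite (nth_map 0) ?size_iota // nth_iota.
  by rewrite [nth 0 _ _]nth_default // nth_default // size_map size_iota.
have szE r : size (nth [::] T r) = nth 0 la r by rewrite rowE size_map size_iota.
have eE r c : c < nth 0 la r -> entry T r c = g r c.
  by move=> lt; rewrite /entry rowE (nth_map 0) ?size_iota // nth_iota.
have sh : map size T = la.
  apply: (@eq_from_nth _ 0); first by rewrite !size_map size_iota.
  by move=> r _; rewrite nth_shape szE.
have fF : filling la T = F.
  apply/ffunP => b; rewrite ffunE eE ?gE //.
  by have /and3P[] := box_mem b; lia.
exists T; split=> //.
apply: tableau_intro => [r|r|r|r c]; rewrite ?szE.
+ rewrite size_map size_iota => lt; case/and3P: pla => _ n0 _.
  by rewrite lt0n; apply: contraNneq n0 => <-; rewrite mem_nth.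
+ apply/sorted_nthP => i j leij; rewrite szE => ltj.
  have lti : i < nth 0 la r by lia.
  have [bi [ri ci]] := box_ex lti; have [bj [rj cj]] := box_ex ltj.
  rewrite -/(entry T r i) -/(entry T r j) !eE //.
  have := gE bi; have := gE bj; rewrite ri ci rj cj /= => -> ->.
  move: leij; rewrite leq_eqVlt => /orP[/eqP eij|lt].
    by rewrite (@box_inj _ bi bj) // ?ri ?rj // ci cj eij.
  by apply: (ssF bi bj).1; rewrite ?ri ?rj // ci cj.
+ exact: is_part_shape pla.
+ move=> ltc; have ltc' : c < nth 0 la r by apply: leq_trans ltc (is_part_shape _ pla).
  have [b [rb cb]] := box_ex ltc'; have [b' [rb' cb']] := box_ex ltc.
  rewrite !eE //; have := gE b; have := gE b'; rewrite rb cb rb' cb' /= => -> ->.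
  by apply: (ssF b b').2; rewrite ?cb ?cb' // rb rb'.
Qed.

Lemma schur_coef n la m : is_part n la ->
  schur la m = nelem [set T | [/\ tableau T, map size T = la & monomial (flatten T) = m]]%classic.
Proof.
move=> pla; rewrite /schur monomial_sum_nelem; apply/esym.
apply: (@nelem_bij _ _ _ _ (filling la)).
- move=> T [tT sh mT]; split; first exact: filling_ssyt tT sh.
  by rewrite /= filling_monomial.
- by move=> T T' [_ sh _] [_ sh' _]; exact: filling_inj.
- move=> F [ssF mF]; have [T [tT sh fF]] := filling_surj pla ssF.
  by exists T => //; split=> //; rewrite -(filling_monomial sh) fF.
Qed.

(** * Standard tableaux as Yamanouchi words *)

Lemma card_box mu : #|{: box mu}| = sumn mu.
Proof.
rewrite card_seq_sub ?diagram_uniq // /diagram size_allpairs_dep.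
congr sumn; apply: (@eq_from_nth _ 0); first by rewrite size_map size_iota.
move=> r; rewrite size_map size_iota => lt.
by rewrite (nth_map 0) ?size_iota // ?size_iota nth_iota // add1n.
Qed.

Lemma card_row_prefix mu r l : l <= nth 0 mu r ->
  #|[set b : box mu | (row_of b == r.+1) && (col_of b <= l)]| = l.
Proof.
move=> lel.
have ex (c : 'I_l) : exists b : box mu, row_of b = r.+1 /\ col_of b = c.+1.
  by apply: box_ex; apply: leq_trans (ltn_ord c) lel.
have [f fE] := fin_all_exists ex.
rewrite -[RHS]card_ord -(@card_imset _ _ f) => [|c c' e]; last first.
  by apply: val_inj; apply: succn_inj; rewrite -(fE c).2 -(fE c').2 e.
congr #|pred_of_set _|; apply/setP => b; rewrite inE; apply/idP/imsetP.
  move=> /andP[/eqP rb leb]; have /and3P[_ cb _] := box_mem b.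
  have ltl : (col_of b).-1 < l by lia.
  exists (Ordinal ltl) => //; have [r1 c1] := fE (Ordinal ltl).
  by apply: box_inj; rewrite ?r1 ?rb // c1 /= prednK.
by move=> [c _ ->]; have [-> ->] := fE c; rewrite eqxx ltn_ord.
Qed.

Lemma count_take_mono r i j (y : seq nat) : i <= j ->
  count_mem r (take i y) <= count_mem r (take j y).
Proof.
move=> leij; rewrite -(subnKC leij) takeD count_cat; lia.
Qed.

Lemma count_take_lt r i j (y : seq nat) : i < j -> i < size y -> nth 0 y i = r ->
  count_mem r (take i y) < count_mem r (take j y).
Proof.
move=> ltij lti yi; apply: leq_trans (count_take_mono r y ltij).
by rewrite (take_nth 0) // -cats1 count_cat /= yi eqxx; lia.
Qed.

Lemma occurrence (r c : nat) (y : seq nat) : c < count_mem r y ->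
  exists t, [/\ t < size y, nth 0 y t = r & count_mem r (take t y) = c].
Proof.
elim/last_ind: y => [//|y x IHy]; rewrite -cats1 count_cat /= addn0 => lt.
have [ltc|gec] := ltnP c (count_mem r y).
  have [t [ltt yt ct]] := IHy ltc; exists t.
  by rewrite size_cat addn1 nth_cat ltt takel_cat ?(ltnW ltt) //; split=> //;
    exact: ltnW.
have xr : x = r by apply/eqP; move: lt; case: eqP => //= _; rewrite addn0 ltnNge gec.
exists (size y); rewrite size_cat nth_cat ltnn subnn take_size_cat //= addn1;
  split=> //.
by apply/eqP; rewrite eqn_leq gec /=; move: lt; rewrite xr eqxx addn1 ltnS.
Qed.

Lemma yamanouchi_le y j r r' : yamanouchi y -> r <= r' ->
  count_mem r' (take j y) <= count_mem r (take j y).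
Proof.
move=> Y; elim: r' => [|r' IHr]; first by rewrite leqn0 => /eqP ->.
rewrite leq_eqVlt => /orP[/eqP -> //|]; rewrite ltnS => /IHr.
exact: leq_trans (Y j r').
Qed.

Section RowWord.
Variable mu : seq nat.
Local Notation n := (sumn mu).
Implicit Type T : {ffun box mu -> 'I_n}.

Lemma is_sytP T : is_syt T <-> injective T /\
  (forall b c : box mu, (row_of b = row_of c -> col_of b < col_of c -> T b < T c) /\
                  (col_of b = col_of c -> row_of b < row_of c -> T b < T c)).
Proof.
split=> [/andP[/injectiveP inj /forallP H]|[inj H]].
  split=> // b c; have /andP[/implyP H1 /implyP H2] := forallP (H b) c.
  by split=> e lt; [apply: H1|apply: H2]; rewrite e eqxx.
apply/andP; split; first exact/injectiveP.
apply/forallP => b; apply/forallP => c; have [H1 H2] := H b c.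
by apply/andP; split; apply/implyP => /andP[/eqP e lt]; [exact: H1|exact: H2].
Qed.

Definition row_word T : seq nat :=
  [seq (if [pick b | T b == t] is Some b then (row_of b).-1 else 0) | t <- enum 'I_n].

Lemma size_row_word T : size (row_word T) = n.
Proof. by rewrite size_map size_enum_ord. Qed.

Lemma nth_row_word T b : injective T -> nth 0 (row_word T) (T b) = (row_of b).-1.
Proof.
move=> inj; rewrite (nth_map (T b)) ?size_enum_ord // nth_ord_enum.
by case: pickP => [c /eqP/inj -> //|/(_ b)]; rewrite eqxx.
Qed.

Lemma syt_onto T (t : 'I_n) : injective T -> exists b, T b = t.
Proof.
move=> inj; have [|g _ gK] := @inj_card_bij _ _ T inj;
  first by rewrite card_ord card_box.
by exists (g t).
Qed.

Lemma count_row_word T r t : injective T -> t <= n ->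
  count_mem r (take t (row_word T)) = #|[set b | (row_of b == r.+1) && (T b < t)]|.
Proof.
move=> inj; elim: t => [_|t IHt lt].
  by rewrite take0 /=; apply/esym/eqP; rewrite cards_eq0; apply/eqP/setP => b;
    rewrite !inE andbF.
have [b0 b0E] := syt_onto (Ordinal lt) inj.
rewrite (take_nth 0) ?size_row_word // -cats1 count_cat /= addn0 IHt 1?ltnW //.
have -> : t = T b0 by rewrite b0E.
rewrite nth_row_word //; have /and3P[rb0 _ _] := box_mem b0.
case: eqP => [e|ne] /=.
  rewrite addn1 [in RHS](cardsD1 b0) !inE -e prednK // eqxx leqnn add1n; congr _.+1.
  apply: eq_card => b; rewrite !inE ltnS [T b <= _]leq_eqVlt.
  case: (b =P b0) => [->|nb] /=; first by rewrite ltnn andbF.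
  by case: (T b =P T b0 :> nat) => // /val_inj/inj.
rewrite addn0; apply: eq_card => b; rewrite !inE ltnS [T b <= _]leq_eqVlt.
case: (T b =P T b0 :> nat) => [/val_inj/inj ->|] //=.
by rewrite andbT ltnn andbF; apply/esym/eqP => e; case: ne; rewrite e.
Qed.

(** Moving one box upwards maps the boxes of row [r + 1] with entry below [t]
    injectively to such boxes of row [r]. *)
Lemma row_word_yamanouchi m T : is_part m mu -> is_syt T -> yamanouchi (row_word T).
Proof.
move=> pmu /is_sytP [inj H] j r.
suff W t : t <= n -> count_mem r.+1 (take t (row_word T)) <= count_mem r (take t (row_word T)).
  have [le|/ltnW ge] := leqP j n; first exact: W.
  by have := W n (leqnn n);
    rewrite -[X in take X _](size_row_word T) take_size take_oversize // size_row_word.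
move=> le; rewrite !count_row_word //.
pose up (b : box mu) : box mu := if insub ((row_of b).-1, col_of b) is Some c then c else b.
have upE b : row_of b = r.+2 -> row_of (up b) = r.+1 /\ col_of (up b) = col_of b.
  move=> rb; have mb : ((row_of b).-1, col_of b) \in diagram mu.
    have /and3P[_ cb leb] := box_mem b; rewrite mem_diagram rb cb /=.
    by apply: leq_trans leb _; rewrite rb; exact: is_part_shape pmu.
  by rewrite /up insubT /row_of /col_of /= -/(row_of b) rb.
rewrite -(@card_in_imset _ _ up) => [|b c]; last first.
  rewrite !inE => /andP[/eqP rb _] /andP[/eqP rc _] e.
  by apply: box_inj; [rewrite rb rc|rewrite -(upE b rb).2 -(upE c rc).2 e].
apply: subset_leq_card; apply/fintype.subsetP => c /imsetP[b].
rewrite inE => /andP[/eqP rb ltb] ->; have [r1 c1] := upE b rb.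
rewrite inE r1 eqxx; apply: ltn_trans ltb; apply: (H _ _).2 => //.
by rewrite r1 rb.
Qed.

Lemma row_word_count T r : injective T -> count_mem r (row_word T) = nth 0 mu r.
Proof.
move=> inj; rewrite -[row_word T]take_size size_row_word count_row_word //.
rewrite -[RHS](card_row_prefix (leqnn _)); apply: eq_card => b;
  rewrite !inE ltn_ord andbT.
by case: eqP => //= e; have /and3P[_ _] := box_mem b; rewrite e.
Qed.

(** As rows increase, [T b] is the time of the occurrence of the row of [b]
    whose rank among the occurrences is the column of [b]; hence [T] is
    determined by its row word. *)
Lemma syt_position T b : is_syt T ->
  count_mem (row_of b).-1 (take (T b) (row_word T)) = (col_of b).-1.
Proof.
move=> /is_sytP [inj H]; have /and3P[rb cb leb] := box_mem b.
rewrite count_row_word ?(ltnW (ltn_ord _)) // prednK //.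
have <- := @card_row_prefix mu (row_of b).-1 (col_of b).-1; last by lia.
apply: eq_card => c; rewrite !inE prednK //; case: eqP => //= e.
case: (ltngtP (col_of c) (col_of b)) => [lt|lt|ec].
- by rewrite (H c b).1 //; lia.
- by have := (H b c).1 (esym e) lt; lia.
- by rewrite (box_inj e ec) ltnn; lia.
Qed.

Lemma row_word_inj T T' : is_syt T -> is_syt T' -> row_word T = row_word T' -> T = T'.
Proof.
move=> sT sT' e; apply/ffunP => b; apply: val_inj => /=.
have c1 := syt_position b sT; have c2 := syt_position b sT'.
have [inj _] := (is_sytP T).1 sT; have [inj' _] := (is_sytP T').1 sT'.
have n1 := nth_row_word b inj; have n2 := nth_row_word b inj'.
rewrite -e in c2 n2.
case: (ltngtP (T b) (T' b)) => // lt.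
  by have := count_take_lt lt _ n1;
    rewrite size_row_word ltn_ord c1 c2 ltnn => /(_ isT).
by have := count_take_lt lt _ n2; rewrite size_row_word ltn_ord c1 c2 ltnn => /(_ isT).
Qed.

(** The entry of the box [b] is chosen as in [syt_position].  Columns are
    increasing since in a Yamanouchi word the [j]-th occurrence of a row index
    comes after the [j]-th occurrence of any smaller one. *)
Lemma row_word_surj y : yamanouchi y -> size y = n -> (forall r, count_mem r y = nth 0 mu r) ->
  exists2 T, is_syt T & row_word T = y.
Proof.
move=> Y szy cy.
have ex (b : box mu) : exists t : 'I_n, nth 0 y t = (row_of b).-1 /\
    count_mem (row_of b).-1 (take t y) = (col_of b).-1.
  have /and3P[rb cb leb] := box_mem b.
  have [|t [ltt yt ct]] := @occurrence (row_of b).-1 (col_of b).-1 y;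
    first by rewrite cy; lia.
  by rewrite szy in ltt; exists (Ordinal ltt).
have [f fE] := fin_all_exists ex.
pose T : {ffun box mu -> 'I_n} := [ffun b => f b].
have TE b : T b = f b by rewrite ffunE.
have inj : injective T.
  move=> b c; rewrite !TE => e; have [n1 c1] := fE b; have [n2 c2] := fE c.
  have /and3P[rb cb _] := box_mem b; have /and3P[rc cc _] := box_mem c.
  by apply: box_inj; rewrite e n2 in n1; rewrite e -n1 c2 in c1; lia.
exists T.
  apply/is_sytP; split=> // b c; rewrite !TE.
  have [n1 c1] := fE b; have [n2 c2] := fE c.
  have /and3P[rb cb _] := box_mem b; have /and3P[rc cc _] := box_mem c.
  split=> e lt; rewrite ltnNge; apply/negP => le.
    by have := count_take_mono (row_of b).-1 y le; rewrite c1 e c2; lia.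
  have ne : f c != f b :> nat by apply/eqP => /= e'; rewrite e' n1 in n2; lia.
  have lt' : f c < f b by rewrite ltn_neqAle ne.
  have ltr : (row_of b).-1 <= (row_of c).-1 by lia.
  have := count_take_mono (row_of b).-1 y lt'; rewrite c1 e.
  have := yamanouchi_le (f c).+1 Y ltr.
  by rewrite (take_nth 0) ?szy // -cats1 !count_cat n2 c2 /= eqxx; lia.
apply: (@eq_from_nth _ 0); rewrite size_row_word // => t ltt.
have [b bE] := syt_onto (Ordinal ltt) inj.
have -> : t = T b by rewrite bE.
by rewrite nth_row_word // TE (fE b).1.
Qed.

End RowWord.

Definition lattice_words (mu : seq nat) : set (seq nat) :=
  [set y | [/\ yamanouchi y, size y = sumn mu & forall r, count_mem r y = nth 0 mu r]]%classic.

Lemma nelem_lattice_words n mu : is_part n mu -> nelem (lattice_words mu) = ((num_syt mu)%:R)%R.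
Proof.
move=> pmu; rewrite /num_syt -nelem_finset; apply/esym.
apply: (@nelem_bij _ _ _ _ (@row_word mu)).
- move=> T; rewrite /= inE => sT; split; first exact: row_word_yamanouchi pmu sT.
    exact: size_row_word.
  by move=> r; apply: row_word_count; case/is_sytP: sT.
- by move=> T T'; rewrite /= !inE; exact: row_word_inj.
- move=> y [Y szy cy]; have [T sT e] := row_word_surj Y szy cy.
  by exists T; rewrite //= inE.
Qed.

(** * Cutting the first row *)

Lemma yamanouchi_catl y z : yamanouchi (y ++ z) -> yamanouchi y.
Proof.
move=> Y j r; have := Y (minn j (size y)) r; rewrite takel_cat ?geq_minr //.
by rewrite /minn; case: ltnP => // le; rewrite take_size [take j y]take_oversize.
Qed.

Lemma nseqSr T d (x : T) : nseq d.+1 x = rcons (nseq d x) x.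
Proof. by rewrite -addn1 nseqD /= cats1. Qed.

Lemma yamanouchi_cat_zeros y d : yamanouchi y -> yamanouchi (y ++ nseq d 0).
Proof.
move=> Y; elim: d => [|d IHd]; first by rewrite cats0.
rewrite nseqSr -rcons_cat; apply/yamanouchi_rcons; split=> // r.
have := yamanouchi_nonincr IHd r; rewrite -cats1 !count_cat /=; lia.
Qed.

Lemma zeros_beyond_cat k y d : count_mem 0 y <= k -> zeros_beyond k (y ++ nseq d 0).
Proof.
move=> le; elim: d => [|d IHd].
  rewrite cats0 => j _ lt; have := count_take_mono 0 y (leq_maxl j (size y)).
  by rewrite [take (maxn _ _) y]take_oversize ?leq_maxr //; lia.
by rewrite nseqSr -rcons_cat; apply/zeros_beyond_rcons.
Qed.

Lemma zeros_beyond_decomp k y : zeros_beyond k y -> exists y', y = y' ++ nseq (count_mem 0 y - k) 0.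
Proof.
elim/last_ind: y => [|y i IHy]; first by exists [::].
move=> /zeros_beyond_rcons [/IHy [y' yE] H].
have cE : count_mem 0 (rcons y i) = count_mem 0 y + (i == 0) by rewrite -cats1 count_cat /= addn0.
have [lt|le] := ltnP k (count_mem 0 y).
  have i0 := H lt; exists y'; rewrite cE i0 eqxx.
  have -> : count_mem 0 y + 1 - k = (count_mem 0 y - k).+1 by lia.
  by rewrite nseqSr -rcons_cat -yE.
have [i0|ni] := eqVneq i 0; last first.
  exists (rcons y i); rewrite cE (negbTE ni);
    have -> : count_mem 0 y + 0 - k = 0 by lia.
  by rewrite cats0.
have [e|ne] := eqVneq (count_mem 0 y) k.
  exists y; rewrite cE i0 e eqxx; have -> : k + 1 - k = 1 by lia.
  by rewrite cats1.
exists (rcons y i); rewrite cE i0 eqxx; have -> : count_mem 0 y + 1 - k = 0 by lia.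
by rewrite cats0.
Qed.

Lemma count_nseq0 r d : count_mem r (nseq d 0) = (r == 0) * d.
Proof. by rewrite count_nseq /= eq_sym. Qed.

(** The second row is at most as long as the first one was before the final
    zeros. *)
Lemma zeros_beyond_count1 k y : yamanouchi y -> zeros_beyond k y -> count_mem 1 y <= k.
Proof.
move=> Y Yy; have [y' yE] := zeros_beyond_decomp Yy.
have c0 : count_mem 0 y = count_mem 0 y' + (count_mem 0 y - k).
  by rewrite {1}yE count_cat count_nseq0 mul1n.
rewrite yE in Y; have := yamanouchi_nonincr (yamanouchi_catl Y) 0.
by rewrite yE count_cat count_nseq0; lia.
Qed.

Lemma nth_cut_first k la r :
  nth 0 (cut_first k la) r = if r == 0 then minn (nth 0 la 0) k else nth 0 la r.
Proof. by case: la => [|a la]; case: r => //=; rewrite min0n. Qed.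

Lemma sumn_cut_first k la : sumn (cut_first k la) + (nth 0 la 0 - k) = sumn la.
Proof. by case: la => [//|a la] /=; lia. Qed.

Lemma cut_first_part k n la : 0 < k -> is_part n la -> nth 0 la 1 <= k ->
  is_part (sumn (cut_first k la)) (cut_first k la).
Proof.
move=> k0 /and3P[srt n0 _]; case: la srt n0 => [//|a la] /= srt n0 le.
rewrite /is_part eqxx andbT /=; apply/andP; split.
  by case: la srt le {n0} => //= b la /andP[leba ->] lebk; rewrite andbT leq_min leba.
by move: n0; rewrite !inE !negb_or => /andP[a0 ->]; rewrite andbT; lia.
Qed.

(** The row words of the shape [la] that satisfy [zeros_beyond k] arise from
    those of the cut shape by appending a fixed number of zeros. *)
Lemma nelem_cut_first k la :
  nelem (lattice_words la `&` zeros_beyond k)%classic = nelem (lattice_words (cut_first k la)).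
Proof.
set d := nth 0 la 0 - k; apply/esym.
have sumE := sumn_cut_first k la.
apply: (@nelem_bij _ _ _ _ (fun y => y ++ nseq d 0)).
- move=> y [Y szy cy]; split; last first.
    by apply: zeros_beyond_cat; rewrite cy nth_cut_first /= geq_minr.
  split; first exact: yamanouchi_cat_zeros.
    by rewrite size_cat size_nseq szy.
  move=> r; rewrite count_cat count_nseq0 cy nth_cut_first.
  by case: eqP => [->|_]; rewrite /d ?mul0n ?addn0 // mul1n; lia.
- move=> y z [_ sy _] [_ sz _] /eqP; rewrite eqseq_cat ?sy ?sz //.
  by move=> /andP[/eqP].
move=> y [[Y szy cy] Yy]; have [y' yE] := zeros_beyond_decomp Yy.
rewrite cy -/d in yE; exists y' => //; split.
- by apply: (@yamanouchi_catl _ (nseq d 0)); rewrite -yE.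
- have : sumn la = size y' + d by rewrite -szy yE size_cat size_nseq.
  by rewrite /d; lia.
move=> r; have := cy r; rewrite {1}yE count_cat count_nseq0 nth_cut_first.
by case: eqP => [->|_]; rewrite /d ?mul1n; lia.
Qed.

(** * The Schur expansion *)

Lemma finite_lattice_words la : finite_set (lattice_words la).
Proof.
have [[y0 [_ _ c0]]|ny] := pselect (exists y, lattice_words la y).
  apply: sub_finite_set (finite_monomial (monomial y0)) => y [_ _ cy];
    apply: monomial_perm.
  by apply/allP => r _ /=; rewrite cy c0.
by apply: (@sub_finite_set _ _ set0) => // y yl; case: ny; exists y.
Qed.

(** A partition of [n] consists of the nonzero terms of an [n]-tuple of integers
    at most [n]. *)
Lemma finite_part n : finite_set [set la | is_part n la].
Proof.
pose f (t : n.-tuple 'I_n.+1) := [seq x <- map val t | x != 0].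
apply: (@sub_finite_set _ _ (f @` setT)%classic); last by apply: finite_image;
  exact: finite_finset.
move=> la /= /and3P[_ n0 /eqP sE].
have nz x : x \in la -> x != 0 by apply: contraTneq => ->.
have sz : size la <= n.
  rewrite -sE; elim: la nz {n0 sE} => //= a la IH nz.
  have le : size la <= sumn la by apply: IH => x xl; apply: nz; rewrite inE xl orbT.
  by have := nz a (mem_head _ _); lia.
have le x : x \in la -> x <= n.
  move=> xl; rewrite -sE; elim: la xl {n0 sE nz sz} => //= a la IH.
  by rewrite inE => /orP[/eqP ->|/IH]; lia.
have st : size (map (@inord n) (la ++ nseq (n - size la) 0)) == n.
  by rewrite size_map size_cat size_nseq subnKC.
exists (Tuple st) => //; rewrite /f /= -map_comp.
have -> : map (val \o @inord n) (la ++ nseq (n - size la) 0) = la ++ nseq (n - size la) 0.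
  rewrite -[RHS]map_id; apply/eq_in_map => x; rewrite mem_cat => /orP[/le lex|].
    by rewrite /= inordK.
  by rewrite mem_nseq => /andP[_ /eqP ->]; rewrite /= inordK.
rewrite filter_cat filter_nseq /= cats0; apply/all_filterP/allP; exact: nz.
Qed.

Lemma mem_H n k la : H n k.+1 la <-> is_part n la /\ nth 0 la 1 <= k.
Proof.
by rewrite /H /= mem_diagram /= -ltnNge ltnS.
Qed.

Lemma tableau_is_part T : tableau T -> is_part (size (flatten T)) (map size T).
Proof.
move=> tT; apply/and3P; split; last by rewrite size_flatten.
  apply/(sortedP 0) => r; rewrite size_map => lt; rewrite !nth_shape.
  exact: tableau_size.
apply/negP => /mapP[w]; elim: T tT => //= r T IHT [r0 _ _ tT].
by rewrite inE => /orP[/eqP ->|]; [lia|exact: IHT].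
Qed.

Section Counting.
Variables (k n : nat) (m : {cmonom nat}).
Hypothesis k0 : 0 < k.

Lemma nelem_rising_runs :
  nelem [set u | [/\ size u = n, monomial u = m & rising_runs k u]]%classic =
  nelem [set u | [/\ size u = n, monomial u = m & rising_tail k u]]%classic.
Proof.
apply: (@nelem_bij _ _ _ _ (straighten k)).
- move=> u [szu mu _]; split; last exact: straighten_rising_tail.
    by rewrite (perm_size (straighten_perm k u)).
  by rewrite (monomial_perm (straighten_perm k u)).
- by move=> u v [_ _ Wu] [_ _ Wv]; exact: straighten_inj.
- move=> w [szw mw /(straighten_surj k0) [u Wu e]]; exists u => //; split=> //.
    by rewrite -(perm_size (straighten_perm k u)) e.
  by rewrite -(monomial_perm (straighten_perm k u)) e.
Qed.

(** Through the correspondence, the choices of the row word and of the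
    semistandard tableau are independent. *)
Lemma nelem_rising_tail_shape la : is_part n la ->
  nelem [set u | [/\ size u = n, monomial u = m, rising_tail k u & map size (rsk u).1 = la]]%classic =
  (nelem (lattice_words la `&` zeros_beyond k)%classic * schur la m)%R.
Proof.
move=> pla;
  rewrite (@nelem_partition _ _ _ (lattice_words la `&` zeros_beyond k)%classic (fun u => (rsk u).2)).
- rewrite {2}/nelem mulr_fsuml; apply: eq_fsbigr => y; rewrite inE => -[[Y szy cy] Yy].
  rewrite mul1r (schur_coef _ pla).
  apply: (@nelem_bij _ _ _ _ (fun u => (rsk u).1)).
  + move=> u [[_ mu _ sh] _]; split=> //; first exact: rsk_tableau.
    by rewrite (monomial_perm (rsk_perm u)).
  + move=> u v [_ yu] [_ yv] e; apply: rsk_inj.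
    by rewrite [LHS]surjective_pairing [RHS]surjective_pairing e yu yv.
  + move=> T [tT sh mT]; have [r|u uE] := rsk_surj tT Y.
      by rewrite cy -sh nth_shape.
    have pu := rsk_perm u; rewrite uE /= in pu.
    exists u; last by rewrite uE.
    split; last by rewrite /= uE.
    split; rewrite ?uE //.
    * rewrite -(perm_size pu) size_flatten /shape sh; by case/and3P: pla => _ _ /eqP.
    * by rewrite -(monomial_perm pu).
    * by apply/rising_tail_rsk; rewrite uE.
- by apply: sub_finite_set (finite_monomial m) => u [].
- by apply: sub_finite_set (finite_lattice_words la) => y [].
- move=> u [szu _ /rising_tail_rsk Yu sh]; split=> //; split;
  first exact: rsk_yamanouchi.
  + have : size (rsk u).2 = size u by elim/last_ind: {szu Yu sh} u => // u x;
    rewrite rsk_rcons /= !size_rcons => ->.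
    by move=> ->; case/and3P: pla => _ _ /eqP ->.
  + by move=> r; rewrite -size_rsk -sh nth_shape.
Qed.

(** The words are grouped by the shape of their tableau. *)
Lemma nelem_rising_tail :
  nelem [set u | [/\ size u = n, monomial u = m & rising_tail k u]]%classic =
  (\sum_(la \in H n k.+1) (schur la m *+ num_syt (cut_first k la)))%R.
Proof.
have finH : finite_set (H n k.+1).
  by apply: sub_finite_set (finite_part n) => la [].
rewrite (@nelem_partition _ _ _ (H n k.+1) (fun u => map size (rsk u).1)) //.
- apply: eq_fsbigr => la; rewrite inE => /mem_H [pla le].
  rewrite -mulr_natl -(nelem_lattice_words (cut_first_part k0 pla le)) -nelem_cut_first -nelem_rising_tail_shape //.
  congr nelem; apply/seteqP; split=> u; first by move=> [[? ? ?] ?].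
  by move=> [? ? ? ?].
- by apply: sub_finite_set (finite_monomial m) => u [].
- move=> u [szu _ /rising_tail_rsk Yu]; apply/mem_H; split.
    by have := tableau_is_part (rsk_tableau u); rewrite (perm_size (rsk_perm u)) szu.
  by rewrite nth_shape size_rsk; exact: zeros_beyond_count1 (rsk_yamanouchi u) Yu.
Qed.

End Counting.

Theorem theorem4p1 (k : nat) (hk : (1 <= k)%N) (n : nat) :
  Q n (Pi_k2 k) = Q n (Pi_k1 k) /\
  Q n (Pi_k1 k) =
    (\sum_(la \in H n k.+1) (schur la *+ num_syt (cut_first k la)))%R.
Proof.
have Q2 m : Q n (Pi_k2 k) m = nelem [set u | [/\ size u = n, monomial u = m & rising_tail k u]]%classic.
  rewrite Q_coef; congr nelem; apply/seteqP; split=> u [<- ? ?]; split=> //;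
    exact/avoiders_Pi_k2.
have Q1 m : Q n (Pi_k1 k) m = nelem [set u | [/\ size u = n, monomial u = m & rising_tail k u]]%classic.
  rewrite -(nelem_rising_runs n m hk) Q_coef; congr nelem.
  apply/seteqP; split=> u [<- ? ?]; split=> //; exact/avoiders_Pi_k1.
split; apply: funext => m; first by rewrite Q1 Q2.
have finH : finite_set (H n k.+1).
  by apply: sub_finite_set (finite_part n) => la [].
rewrite Q1 (nelem_rising_tail n m hk) !fsbig_finite // fct_sumE.
by apply: eq_bigr => la _; elim: (num_syt _) => // f IHf; rewrite !mulrS IHf.
Qed.
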